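(* Suppose $F$ is purely even and symmetric (i.e. its Nakayama automorphism $\psi$ is the identity). Let $n\ge1$, $d\in\mathbb{N}$, and let $\mathbf{c}^{(1)},\dots,\mathbf{c}^{(d)}\in(Z(F)^{\otimes n})^{S_n}$ be elements of degree $\delta$, where $Z(F)$ is the center of $F$. Let $\mathcal{A}_n^{\mathbf{C}}(F)$ be the quotient of $\mathcal{A}_n(F)$ by the two-sided ideal generated by $\prod_{j=1}^d(x_1-\mathbf{c}^{(j)})$. Then the canonical images of the elements $$\{x^\alpha\mathbf{b}\pi\mid\alpha\in\mathbb{N}^n\text{ with }\alpha_1,\dots,\alpha_n<d,\ \mathbf{b}\in B^{\otimes n},\ \pi\in S_n\}$$ form a $\Bbbk$-basis for $\mathcal{A}_n^{\mathbf{C}}(F)$.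
   Context: $\Bbbk$ is a commutative ring of characteristic not equal to $2$; $\mathbb{N}$ is the set of nonnegative integers. $F$ is an $\mathbb{N}$-graded associative unital $\Bbbk$-algebra (all elements of even parity), free of finite rank over $\Bbbk$, with a linear trace map $\operatorname{tr}\colon F\to\Bbbk$, homogeneous in degree, such that $f\mapsto(g\mapsto\operatorname{tr}(gf))$ is an isomorphism $F\to\operatorname{Hom}_\Bbbk(F,\Bbbk)$; symmetric means $\operatorname{tr}(fg)=\operatorname{tr}(gf)$ for all $f,g$. $\delta$ is the maximum degree of elements of $F$. $B$ is a homogeneous basis of $F$ and $\{b^\vee\mid b\in B\}$ its dual basis: $\operatorname{tr}(b^\vee c)=\delta_{b,c}$. $B^{\otimes n}=\{b_1\otimes\cdots\otimes b_n\mid b_i\in B\}$. For $f\in F$, $f_i=1^{\otimes(i-1)}\otimes f\otimes1^{\otimes(n-i)}\in F^{\otimes n}$. $S_n$ acts on $F^{\otimes n}$ by permuting factors, written ${}^\pi\mathbf{f}$; $s_i$ is the transposition of $i,i+1$. In this setting the affine wreath product algebra $\mathcal{A}_n(F)$ is the free product $\Bbbk[x_1,\dots,x_n]\star F^{\otimes n}\star\Bbbk S_n$ modulo the relations: $\mathbf{f}x_i=x_i\mathbf{f}$ ($\mathbf f\in F^{\otimes n}$); $s_ix_j=x_js_i$ ($j\ne i,i+1$); $s_ix_i=x_{i+1}s_i-t_{i,i+1}$; $\pi\mathbf{f}={}^\pi\mathbf{f}\,\pi$ ($\pi\in S_n$), where $t_{i,j}=\sum_{b\in B}b_i(b^\vee)_j$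 for $i\neq j$. It is graded with $|x_i|=\delta$, $|f_i|=|f|$, $|\pi|=0$. For $\alpha\in\mathbb{N}^n$, $x^\alpha=x_1^{\alpha_1}\cdots x_n^{\alpha_n}$. *)

(* Defs.v *)
From HB Require Import structures.
From mathcomp Require Import all_boot all_fingroup all_algebra.
From mathcomp Require Import finmap boolp monalg.

Set Implicit Arguments.
Unset Strict Implicit.
Unset Printing Implicit Defensive.

Import GRing.Theory.
Local Open Scope ring_scope.
Local Open Scope quotient_scope.

Local Notation repr := generic_quotient.repr.

(* [algType] requires [1 != 0], which may fail in a quotient by a two-sided   *)
(* ideal.  An associative unital k-algebra, possibly zero, is therefore       *)
(* encoded as a [pzRingType] with a central ring morphism from k; its carrier *)
(* is then both a [pzRingType] and an [lmodType k].                           *)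
Record kalg (k : comNzRingType) := KAlg {
  kalg_ring : pzRingType;
  kalg_struct : {rmorphism k -> kalg_ring};
  kalg_structC : forall c a, kalg_struct c * a = a * kalg_struct c }.

Definition kalg_sort (k : comNzRingType) (A : kalg k) : Type := kalg_ring A.
Coercion kalg_sort : kalg >-> Sortclass.

Section KAlgTheory.
Variables (k : comNzRingType) (A : kalg k).

HB.instance Definition _ := GRing.PzRing.copy (kalg_sort A) (kalg_ring A).

Definition kconst (c : k) : A := kalg_struct A c.

Fact kconst_is_zmod_morphism : zmod_morphism kconst.
Proof. exact: (rmorphB (kalg_struct A)). Qed.
Fact kconst_is_monoid_morphism : monoid_morphism kconst.
Proof. by split; [exact: (rmorph1 (kalg_struct A))|exact: (rmorphM (kalg_struct A))]. Qed.
HB.instance Definition _ :=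
  GRing.isZmodMorphism.Build k A kconst kconst_is_zmod_morphism.
HB.instance Definition _ :=
  GRing.isMonoidMorphism.Build k A kconst kconst_is_monoid_morphism.

Lemma kconstC (c : k) (a : A) : kconst c * a = a * kconst c.
Proof. exact: kalg_structC. Qed.

Definition kscale (c : k) (a : A) : A := locked (kconst c * a).

Fact kscaleA a b v : kscale a (kscale b v) = kscale (a * b) v.
Proof. by rewrite /kscale -!lock mulrA rmorphM. Qed.
Fact kscale1 : left_id 1 kscale.
Proof. by move=> v; rewrite /kscale -lock rmorph1 mul1r. Qed.
Fact kscaleDr : right_distributive kscale +%R.
Proof. by move=> a u v; rewrite /kscale -!lock mulrDr. Qed.
Fact kscaleDl v : {morph kscale^~ v : a b / a + b}.
Proof. by move=> a b; rewrite /kscale -!lock rmorphD mulrDl. Qed.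
HB.instance Definition _ := GRing.Zmodule_isLmodule.Build k (kalg_sort A)
  kscaleA kscale1 kscaleDr kscaleDl.

Lemma kscaleE (c : k) (a : A) : c *: a = kconst c * a.
Proof. by rewrite [LHS]/(_ *: _) /= /kscale -lock. Qed.
Lemma kscaleAl (c : k) (a b : A) : c *: (a * b) = (c *: a) * b.
Proof. by rewrite !kscaleE mulrA. Qed.
Lemma kscaleAr (c : k) (a b : A) : c *: (a * b) = a * (c *: b).
Proof. by rewrite !kscaleE !mulrA kconstC. Qed.

End KAlgTheory.

Section Modules.
Variables (k : comNzRingType) (M : lmodType k).

Inductive span (S : M -> Prop) : M -> Prop :=
  | span_gen x of S x : span S x
  | span_zero : span S 0
  | span_add x y of span S x & span S y : span S (x + y)
  | span_scale (c : k) x of span S x : span S (c *: x).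

Definition is_basis (E : finType) (v : E -> M) : Prop :=
  (forall m : M, exists c : E -> k, m = \sum_e c e *: v e) /\
  (forall c : E -> k, \sum_e c e *: v e = 0 -> forall e, c e = 0).

End Modules.

Section QuotientAlgebra.
Variables (k : comNzRingType) (A : kalg k) (S : A -> Prop).

Inductive ideal_gen_by : A -> Prop :=
  | ideal_gen x of S x : ideal_gen_by x
  | ideal_zero : ideal_gen_by 0
  | ideal_add x y of ideal_gen_by x & ideal_gen_by y : ideal_gen_by (x + y)
  | ideal_mull a x of ideal_gen_by x : ideal_gen_by (a * x)
  | ideal_mulr a x of ideal_gen_by x : ideal_gen_by (x * a).

Lemma ideal_opp x : ideal_gen_by x -> ideal_gen_by (- x).
Proof. by move=> Ix; rewrite -mulN1r; apply: ideal_mull. Qed.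

Definition ideal_eq (x y : A) : bool := `[< ideal_gen_by (x - y) >].

Fact ideal_eq_refl : reflexive ideal_eq.
Proof. by move=> x; apply/asboolP; rewrite subrr; apply: ideal_zero. Qed.
Fact ideal_eq_sym : symmetric ideal_eq.
Proof.
move=> x y; apply/asboolP/asboolP => /ideal_opp; by rewrite opprB.
Qed.
Fact ideal_eq_trans : transitive ideal_eq.
Proof.
move=> y x z /asboolP Ixy /asboolP Iyz; apply/asboolP.
by rewrite -(subrK y x) -addrA; apply: ideal_add.
Qed.

Canonical ideal_equiv :=
  EquivRel ideal_eq ideal_eq_refl ideal_eq_sym ideal_eq_trans.

Definition quot_carrier := {eq_quot ideal_equiv}.
HB.instance Definition _ := Choice.on quot_carrier.
HB.instance Definition _ := EqQuotient.on quot_carrier.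

Lemma quot_eqP (x y : A) :
  \pi_quot_carrier x = \pi_quot_carrier y <-> ideal_gen_by (x - y).
Proof.
by split=> [/eqquotP /asboolP | ] // Ixy; apply/eqquotP/asboolP.
Qed.

Let q (x : A) : quot_carrier := \pi x.

Let qadd (u v : quot_carrier) := q (repr u + repr v).
Let qopp (u : quot_carrier) := q (- repr u).
Let qmul (u v : quot_carrier) := q (repr u * repr v).

Let qE x y : ideal_gen_by (x - y) -> q x = q y.
Proof. by move=> h; apply/quot_eqP. Qed.
Let qrepr x : ideal_gen_by (repr (q x) - x).
Proof. by apply/quot_eqP; rewrite reprK. Qed.
Let qP (u : quot_carrier) : exists x, u = q x.
Proof. by exists (repr u); rewrite /q reprK. Qed.

Let qaddE x y : qadd (q x) (q y) = q (x + y).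
Proof. by apply: qE; rewrite opprD addrACA; apply: ideal_add. Qed.
Let qoppE x : qopp (q x) = q (- x).
Proof. by apply: qE; rewrite -opprB opprK addrC; apply/ideal_opp/qrepr. Qed.
Let qmulE x y : qmul (q x) (q y) = q (x * y).
Proof.
apply: qE; rewrite -(subrKA (repr (q x) * y)) -mulrBr -mulrBl.
by apply: ideal_add; [apply: ideal_mull|apply: ideal_mulr].
Qed.

Let qaddA : associative qadd.
Proof.
by move=> u v w; case: (qP u) (qP v) (qP w) => x -> [y ->] [z ->]; rewrite !qaddE addrA.
Qed.
Let qaddC : commutative qadd.
Proof. by move=> u v; rewrite /qadd addrC. Qed.
Let qadd0 : left_id (q 0) qadd.
Proof. by move=> u; case: (qP u) => x ->; rewrite qaddE add0r. Qed.
Let qaddN : left_inverse (q 0) qopp qadd.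
Proof. by move=> u; case: (qP u) => x ->; rewrite qoppE qaddE addNr. Qed.

HB.instance Definition _ :=
  GRing.isZmodule.Build quot_carrier qaddA qaddC qadd0 qaddN.

Let qmulA : associative qmul.
Proof.
by move=> u v w; case: (qP u) (qP v) (qP w) => x -> [y ->] [z ->]; rewrite !qmulE mulrA.
Qed.
Let qmul1 : left_id (q 1) qmul.
Proof. by move=> u; case: (qP u) => x ->; rewrite qmulE mul1r. Qed.
Let qmulr1 : right_id (q 1) qmul.
Proof. by move=> u; case: (qP u) => x ->; rewrite qmulE mulr1. Qed.
Let qmulDl : left_distributive qmul qadd.
Proof.
move=> u v w; case: (qP u) (qP v) (qP w) => x -> [y ->] [z ->].
by rewrite qaddE !qmulE qaddE mulrDl.
Qed.
Let qmulDr : right_distributive qmul qadd.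
Proof.
move=> u v w; case: (qP u) (qP v) (qP w) => x -> [y ->] [z ->].
by rewrite qaddE !qmulE qaddE mulrDr.
Qed.

HB.instance Definition _ :=
  GRing.Zmodule_isPzRing.Build quot_carrier qmulA qmul1 qmulr1 qmulDl qmulDr.

Definition quot_struct (c : k) : quot_carrier := q (kconst A c).
Let qstructB : zmod_morphism quot_struct.
Proof.
by move=> a b; rewrite /quot_struct rmorphB -qaddE -qoppE.
Qed.
Let qstructM : monoid_morphism quot_struct.
Proof. by split=> [|a b]; rewrite /quot_struct ?rmorph1 // rmorphM -qmulE. Qed.
HB.instance Definition _ :=
  GRing.isZmodMorphism.Build k quot_carrier quot_struct qstructB.
HB.instance Definition _ :=
  GRing.isMonoidMorphism.Build k quot_carrier quot_struct qstructM.
Let qstructC c (u : quot_carrier) : quot_struct c * u = u * quot_struct c.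
Proof.
case: (qP u) => x ->; rewrite /quot_struct.
by rewrite [LHS]qmulE [RHS]qmulE kconstC.
Qed.

Definition quotAlg : kalg k := KAlg qstructC.

Definition quot_pi (a : A) : quotAlg := q a.

Fact quot_pi_is_zmod_morphism : zmod_morphism quot_pi.
Proof. by move=> a b; rewrite /quot_pi -qaddE -qoppE. Qed.
Fact quot_pi_is_monoid_morphism : monoid_morphism quot_pi.
Proof. by split=> // a b; rewrite /quot_pi -qmulE. Qed.
HB.instance Definition _ :=
  GRing.isZmodMorphism.Build A quotAlg quot_pi quot_pi_is_zmod_morphism.
HB.instance Definition _ :=
  GRing.isMonoidMorphism.Build A quotAlg quot_pi quot_pi_is_monoid_morphism.

Lemma quot_pi_const c : quot_pi (kconst A c) = kconst quotAlg c.
Proof. by []. Qed.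
Lemma quot_piZ c a : quot_pi (c *: a) = c *: quot_pi a.
Proof. by rewrite !kscaleE rmorphM. Qed.
Lemma quot_pi_surj (u : quotAlg) : exists a, u = quot_pi a.
Proof. exact: qP. Qed.
Lemma quot_pi_eq0 a : quot_pi a = 0 <-> ideal_gen_by a.
Proof. by rewrite -[a in ideal_gen_by a]subr0; apply: quot_eqP. Qed.

Definition quot_lift (T : Type) (h : A -> T) (u : quotAlg) : T :=
  h (repr (u : quot_carrier)).

Lemma quot_liftE (B : pzRingType) (h : {rmorphism A -> B}) :
  (forall x, S x -> h x = 0) -> forall a, quot_lift h (quot_pi a) = h a.
Proof.
move=> hS a; apply/eqP; rewrite -subr_eq0 -rmorphB; apply/eqP.
elim: (qrepr a) => {a} [x /hS //||x y _ hx _ hy|b x _ hx|b x _ hx].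
- exact: rmorph0.
- by rewrite rmorphD hx hy addr0.
- by rewrite rmorphM hx mulr0.
- by rewrite rmorphM hx mul0r.
Qed.

Lemma quot_lift_is_morphism (B : pzRingType) (h : {rmorphism A -> B}) :
  (forall x, S x -> h x = 0) ->
  zmod_morphism (quot_lift h) * monoid_morphism (quot_lift h).
Proof.
move=> hS; have E := quot_liftE hS.
split=> [u v|]; last split=> [|u v].
- case: (quot_pi_surj u) (quot_pi_surj v) => a -> [b ->].
  by rewrite -rmorphB !E rmorphB.
- by rewrite -(rmorph1 quot_pi) E rmorph1.
- case: (quot_pi_surj u) (quot_pi_surj v) => a -> [b ->].
  by rewrite -rmorphM !E rmorphM.
Qed.

End QuotientAlgebra.

Section FreeAlgebra.
Variables (k : comNzRingType) (X : choiceType).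

(* The free algebra on X is the monoid algebra of the free monoid on X.       *)
Let R : pzRingType := {malg k[{fmonom X}]}.

Fact free_structC (c : k) (a : R) :
  @malgC {fmonom X} k c * a = a * @malgC {fmonom X} k c.
Proof.
rewrite mul_malgC malgZ_def malgM_def fgmulgU.
by apply: eq_bigr => w _; rewrite mulm1 mulrC.
Qed.

Definition freeAlg : kalg k := @KAlg k R (@malgC {fmonom X} k) free_structC.

Definition free_gen (x : X) : freeAlg := << fmu x >> : {malg k[{fmonom X}]}.

Lemma free_scaleE (c : k) (a : freeAlg) :
  c *: a = (c *: (a : {malg k[{fmonom X}]})) :> {malg k[{fmonom X}]}.
Proof. by rewrite kscaleE -mul_malgC. Qed.

Variables (B : kalg k) (h : X -> B).

Definition free_word (w : {fmonom X}) : B := \prod_(x <- (w : seq X)) h x.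

Definition free_lift (a : freeAlg) : B :=
  \sum_(w <- msupp (a : {malg k[{fmonom X}]}))
     (a : {malg k[{fmonom X}]})@_w *: free_word w.

Lemma free_liftEw (d : {fset {fmonom X}}) (a : {malg k[{fmonom X}]}) :
  (msupp a `<=` d)%fset -> free_lift a = \sum_(w <- d) a@_w *: free_word w.
Proof.
move=> le; rewrite [LHS](big_fset_incl _ le) => //= x xd /mcoeff_outdom ->.
by rewrite scale0r.
Qed.

Fact free_lift_is_zmod_morphism : zmod_morphism free_lift.
Proof.
move=> a b; rewrite (@free_liftEw (msupp a `|` msupp b)%fset) ?msuppB_le //.
rewrite (@free_liftEw (msupp a `|` msupp b)%fset a) ?fsubsetUl //.
rewrite (@free_liftEw (msupp a `|` msupp b)%fset b) ?fsubsetUr //.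
by rewrite -sumrB; apply: eq_bigr => w _; rewrite mcoeffB scalerBl.
Qed.
HB.instance Definition _ :=
  GRing.isZmodMorphism.Build freeAlg B free_lift free_lift_is_zmod_morphism.

Lemma free_liftU c w : free_lift << c *g w >> = c *: free_word w.
Proof. by rewrite (free_liftEw msuppU_le) big_seq_fset1 mcoeffUU. Qed.

Lemma free_wordM w1 w2 :
  free_word (mmul w1 w2) = free_word w1 * free_word w2.
Proof. by rewrite /free_word fmM big_cat. Qed.

Fact free_lift_is_monoid_morphism : monoid_morphism free_lift.
Proof.
split=> [|a b].
  have := free_liftU 1 (mone : {fmonom X}).
  by rewrite /free_word fm1 big_nil scale1r.
rewrite [X in free_lift X]malgME raddf_sum /= mulr_suml; apply: eq_bigr => v _.
rewrite raddf_sum /= mulr_sumr; apply: eq_bigr => w _.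
by rewrite free_liftU free_wordM -kscaleAl -kscaleAr scalerA.
Qed.
HB.instance Definition _ :=
  GRing.isMonoidMorphism.Build freeAlg B free_lift free_lift_is_monoid_morphism.

Lemma free_lift_const c : free_lift (kconst freeAlg c) = kconst B c.
Proof.
by rewrite [LHS]free_liftU /free_word fm1 big_nil kscaleE mulr1.
Qed.
Lemma free_liftZ c a : free_lift (c *: a) = c *: free_lift a.
Proof. by rewrite !kscaleE rmorphM -free_lift_const. Qed.
Lemma free_lift_gen x : free_lift (free_gen x) = h x.
Proof. by rewrite free_liftU /free_word fmU big_seq1 scale1r. Qed.

End FreeAlgebra.

Section TensorPower.
Variables (k : comNzRingType) (F : algType k) (n : nat).
Let tup := {ffun 'I_n -> F}.

Definition set_factor (f : tup) (i : 'I_n) (a : F) : tup :=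
  [ffun j => if j == i then a else f j].

Local Notation g := (@free_gen k tup).

(* The relations other than multilinearity present the algebra of the monoid  *)
(* of n-tuples, i.e. the free k-module on the n-tuples with factorwise        *)
(* product.                                                                   *)
Inductive tensor_rel : freeAlg k tup -> Prop :=
  | tensor_add f i a b : tensor_rel
      (g (set_factor f i (a + b)) - (g (set_factor f i a) + g (set_factor f i b)))
  | tensor_scale f i (c : k) a : tensor_rel
      (g (set_factor f i (c *: a)) - c *: g (set_factor f i a))
  | tensor_mul f f' : tensor_rel (g f * g f' - g [ffun i => f i * f' i])
  | tensor_one : tensor_rel (g [ffun => 1] - 1).

Definition tensorPower : kalg k := quotAlg tensor_rel.

Definition pure_tensor (f : tup) : tensorPower := quot_pi tensor_rel (g f).

Definition factor_at (i : 'I_n) (f : F) : tensorPower :=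
  pure_tensor (set_factor [ffun => 1] i f).

Definition permute_tuple (p : 'S_n) (f : tup) : tup :=
  [ffun i => f ((p^-1)%g i)].

Definition tensor_perm (p : 'S_n) : tensorPower -> tensorPower :=
  quot_lift (free_lift (fun f => pure_tensor (permute_tuple p f))).

Lemma pure_tensor_eq (x y : freeAlg k tup) :
  tensor_rel (x - y) -> quot_pi tensor_rel x = quot_pi tensor_rel y.
Proof.
move=> r; apply/eqP; rewrite -subr_eq0 -rmorphB; apply/eqP/quot_pi_eq0.
exact: ideal_gen.
Qed.

Lemma permute_set_factor p f i a :
  permute_tuple p (set_factor f i a) = set_factor (permute_tuple p f) (p i) a.
Proof. by apply/ffunP => j; rewrite !ffunE (canF_eq (permKV p)). Qed.

Lemma tensor_perm_rel (p : 'S_n) x : tensor_rel x ->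
  free_lift (fun f => pure_tensor (permute_tuple p f)) x = 0.
Proof.
move=> rx; pose H : {rmorphism freeAlg k tup -> tensorPower} :=
  free_lift (fun f => pure_tensor (permute_tuple p f)).
suff: forall h : {rmorphism freeAlg k tup -> tensorPower},
    (forall c a, h (c *: a) = c *: h a) ->
    (forall f, h (g f) = quot_pi tensor_rel (g (permute_tuple p f))) ->
    h x = 0.
  by move=> /(_ H); apply=> *; [apply: free_liftZ|apply: free_lift_gen].
move=> {H} h hZ hE; case: rx => [f i a b|f i c a|f f'|];
  rewrite rmorphB; apply/eqP; rewrite subr_eq0; apply/eqP.
- rewrite rmorphD !hE !permute_set_factor -rmorphD.
  exact/pure_tensor_eq/tensor_add.
- rewrite hZ !hE !permute_set_factor -quot_piZ.
  exact/pure_tensor_eq/tensor_scale.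
- rewrite rmorphM !hE -rmorphM.
  have ->: permute_tuple p [ffun i => f i * f' i]
         = [ffun i => permute_tuple p f i * permute_tuple p f' i].
    by apply/ffunP => i; rewrite !ffunE.
  exact/pure_tensor_eq/tensor_mul.
- rewrite rmorph1 hE.
  have ->: permute_tuple p [ffun => 1] = [ffun => 1].
    by apply/ffunP => i; rewrite !ffunE.
  by rewrite -(rmorph1 (quot_pi tensor_rel)); apply/pure_tensor_eq/tensor_one.
Qed.

Fact tensor_perm_is_morphism (p : 'S_n) :
  zmod_morphism (tensor_perm p) * monoid_morphism (tensor_perm p).
Proof. exact: (quot_lift_is_morphism (@tensor_perm_rel p)). Qed.
HB.instance Definition _ (p : 'S_n) :=
  GRing.isZmodMorphism.Build tensorPower tensorPower (tensor_perm p)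
    (tensor_perm_is_morphism p).1.
HB.instance Definition _ (p : 'S_n) :=
  GRing.isMonoidMorphism.Build tensorPower tensorPower (tensor_perm p)
    (tensor_perm_is_morphism p).2.

Lemma tensor_perm_pure p f :
  tensor_perm p (pure_tensor f) = pure_tensor (permute_tuple p f).
Proof.
rewrite /tensor_perm [LHS](quot_liftE (@tensor_perm_rel p)).
exact: free_lift_gen.
Qed.
Lemma tensor_permZ p c t : tensor_perm p (c *: t) = c *: tensor_perm p t.
Proof.
case: (quot_pi_surj t) => a ->; rewrite -quot_piZ /tensor_perm.
rewrite [LHS](quot_liftE (@tensor_perm_rel p)).
by rewrite (quot_liftE (@tensor_perm_rel p)); apply: free_liftZ.
Qed.

(* The image of Z(F)^{\otimes n} in F^{\otimes n}.                            *)
Definition central (z : F) : Prop := forall f : F, z * f = f * z.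
Definition center_tensor : tensorPower -> Prop :=
  span (fun t => exists2 f : tup, forall i, central (f i) & t = pure_tensor f).

Definition perm_invariant (t : tensorPower) : Prop :=
  forall p : 'S_n, tensor_perm p t = t.

Definition tensor_homog (gr : nat -> F -> Prop) (m : nat) : tensorPower -> Prop :=
  span (fun t => exists (f : tup) (deg : 'I_n -> nat),
    [/\ forall i, gr (deg i) (f i), (\sum_i deg i)%N = m & t = pure_tensor f]).

End TensorPower.

Section Frobenius.
Variables (k : comNzRingType) (F : algType k).

(* [gr m f] says that f lies in the homogeneous component of degree m.        *)
Definition is_grading (gr : nat -> F -> Prop) : Prop :=
  [/\ forall m, [/\ gr m 0, forall f g, gr m f -> gr m g -> gr m (f + g)
                  & forall (c : k) f, gr m f -> gr m (c *: f)],
      forall f, exists (N : nat) (h : nat -> F),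
        (forall m, gr m (h m)) /\ f = \sum_(m < N) h m,
      forall (N : nat) (h : nat -> F), (forall m, gr m (h m)) ->
        \sum_(m < N) h m = 0 -> forall m, (m < N)%N -> h m = 0,
      gr 0%N 1
    & forall m p f g, gr m f -> gr p g -> gr (m + p)%N (f * g)].

Definition max_degree (gr : nat -> F -> Prop) (delta : nat) : Prop :=
  (exists2 f, gr delta f & f != 0) /\
  (forall m f, gr m f -> f != 0 -> (m <= delta)%N).

Definition homogeneous_trace (gr : nat -> F -> Prop) (tr : {scalar F}) : Prop :=
  exists e : nat, forall m f, gr m f -> m != e -> tr f = 0.

Definition frobenius_trace (tr : {scalar F}) : Prop :=
  forall phi : {scalar F}, exists! f : F, forall g, phi g = tr (g * f).

Definition symmetric_trace (tr : {scalar F}) : Prop :=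
  forall f g : F, tr (f * g) = tr (g * f).

Definition homogeneous_family (gr : nat -> F -> Prop) (I : Type) (B : I -> F) :=
  forall i, exists m, gr m (B i).

Definition dual_basis (tr : {scalar F}) (I : finType) (B Bdual : I -> F) : Prop :=
  forall b c, tr (Bdual b * B c) = (b == c)%:R.

End Frobenius.

Section AffineWreathProduct.
Variables (k : comNzRingType) (F : algType k) (n : nat).
Variables (I : finType) (B Bdual : I -> F).

Let T : kalg k := tensorPower F n.
Let gens : choiceType := ('I_n + T + 'S_n)%type.

Let X (i : 'I_n) : freeAlg k gens := free_gen k (inl (inl i) : gens).
Let Fe (f : T) : freeAlg k gens := free_gen k (inl (inr f) : gens).
Let P (p : 'S_n) : freeAlg k gens := free_gen k (inr p : gens).

Definition teleporter (i j : 'I_n) : T :=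
  \sum_(b : I) factor_at i (B b) * factor_at j (Bdual b).

(* The relations awpa_xx to awpa_p1 alone present the free product            *)
(* k[x_1,...,x_n] * F^{\otimes n} * k S_n.  In MathComp, [(q * p)%g] is the    *)
(* composite "p after q", i.e. the usual product p q.                         *)
Inductive awpa_rel : freeAlg k gens -> Prop :=
  | awpa_xx i j : awpa_rel (X i * X j - X j * X i)
  | awpa_fD f g : awpa_rel (Fe (f + g) - (Fe f + Fe g))
  | awpa_fZ (c : k) f : awpa_rel (Fe (c *: f) - c *: Fe f)
  | awpa_fM f g : awpa_rel (Fe (f * g) - Fe f * Fe g)
  | awpa_f1 : awpa_rel (Fe 1 - 1)
  | awpa_pM p q : awpa_rel (P (q * p)%g - P p * P q)
  | awpa_p1 : awpa_rel (P 1%g - 1)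
  | awpa_fx f i : awpa_rel (Fe f * X i - X i * Fe f)
  | awpa_sx (i i' j : 'I_n) of i' = i.+1 :> nat & j != i & j != i' :
      awpa_rel (P (tperm i i') * X j - X j * P (tperm i i'))
  | awpa_sxi (i i' : 'I_n) of i' = i.+1 :> nat :
      awpa_rel (P (tperm i i') * X i
                - (X i' * P (tperm i i') - Fe (teleporter i i')))
  | awpa_pf p f : awpa_rel (P p * Fe f - Fe (tensor_perm p f) * P p).

Definition awpa : kalg k := quotAlg awpa_rel.

Definition awpa_x (i : 'I_n) : awpa := quot_pi awpa_rel (X i).
Definition awpa_tensor (f : T) : awpa := quot_pi awpa_rel (Fe f).
Definition awpa_perm (p : 'S_n) : awpa := quot_pi awpa_rel (P p).

Variables (hn : (0 < n)%N) (d : nat) (C : 'I_d -> T).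

Definition cyclotomic_rel (a : awpa) : Prop :=
  a = \prod_(j < d) (awpa_x (Ordinal hn) - awpa_tensor (C j)).

Definition cyclotomic_awpa : kalg k := quotAlg cyclotomic_rel.

Definition cyclotomic_monomial
    (e : {ffun 'I_n -> 'I_d} * {ffun 'I_n -> I} * 'S_n) : cyclotomic_awpa :=
  let: (alpha, b, p) := e in
  quot_pi cyclotomic_rel
    ((\prod_(i < n) awpa_x i ^+ alpha i)
       * awpa_tensor (pure_tensor [ffun i => B (b i)]) * awpa_perm p).

End AffineWreathProduct.

(* Main.v *)
From HB Require Import structures.
From mathcomp Require Import all_boot all_fingroup all_algebra.
From mathcomp Require Import boolp functions monalg.
Require Import Defs.

(** Write T for the n-th tensor power of F, t_ij for the teleporters,
s_ij for the transpositions, and A for the affine wreath product algebra.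
The elements u_ij = t_ij s_ij and their partial sums J_i = sum_(j < i) u_ij are
the analogues of transpositions and Jucys-Murphy elements.  The J_i commute,
and the shifted generators y_i = x_i - J_i satisfy the exact equivariance
w y_i w^-1 = y_(w i) for every permutation w ([S_jm_shift]), with no
correction term.  The whole argument is phrased in terms of the y_i.

The monomials x^g f w (g an exponent, f in T, w a permutation) have
coordinates.  To see this, let A act from the right on the functions of a
permutation and an exponent with values in T.  By equivariance, permutations
act by translation and y_i by an explicit formula, so that no divided
differences appear.  The one relation that is not immediate is that the x_i
commute.  But [x_i, x_j] = [y_i, y_j] + (y_i - y_j) u_ij ([commutatorX]), and
the right side is equivariant; so it vanishes as soon as it vanishes on
functions supported at the identity, where the x_i are shifts of exponents
([model_XC]).  Evaluation in this module gives [awpa_coord].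

Put chi_i = prod_j (y_i - c_j).  Since y_1 = x_1, the element chi_1 generates
the cyclotomic ideal, and the chi_i are its conjugates.  Three facts about
degrees in x drive the proof:
- chi_i is x_i^d plus terms of degree less than d ([cyclo_lead]);
- [x_a, chi_i] is a combination of the chi_l with coefficients from T and the
  permutations only ([X_cyclo]); hence the ideal lies in the span of the
  x^b chi_l f w ([ideal_filt]);
- x_j^d chi_i - x_i^d chi_j is such a combination with all x^b of degree less
  than d, because both terms agree with chi_i chi_j up to lower order
  ([cyclo_spair]).
The last fact is the Buchberger criterion for the leading terms x_i^d.  It
lets one replace the x^b chi_l by a single element for each monomial x^g with
some g_i >= d, with leading term x^g ([filt_cyclo_span]).  These leading terms
being distinct, a nonzero element of the ideal must involve such a monomial
([ideal_reduced]): this is linear independence.  Conversely the first fact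
rewrites every monomial modulo the ideal in terms of those with all g_i < d
([reduce]): this is generation. *)

Set Implicit Arguments.
Unset Strict Implicit.
Unset Printing Implicit Defensive.

Import GRing.Theory.
Local Open Scope ring_scope.

(** * Spans, and induction on free and quotient algebras *)

Section Span.
Variables (k : comNzRingType) (M : lmodType k).
Implicit Types (S : M -> Prop) (m : M).

Lemma span_sum S (I : Type) (r : seq I) (P : pred I) (v : I -> M) :
  (forall i, P i -> span S (v i)) -> span S (\sum_(i <- r | P i) v i).
Proof. by move=> Sv; elim/big_ind: _ => //; [apply: span_zero|apply: span_add]. Qed.

Lemma span_le S S' m :
  (forall x, S x -> span S' x) -> span S m -> span S' m.
Proof.
move=> SS'; elim=> {m} [x /SS' //||x y _ Sx _ Sy|c x _ Sx].
- exact: span_zero.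
- exact: span_add.
- exact: span_scale.
Qed.

Lemma span_family (I : finType) (v : I -> M) m :
  span (fun x => exists i, x = v i) m -> exists c, m = \sum_i c i *: v i.
Proof.
elim=> {m} [x [i ->]||x y _ [c ->] _ [c' ->]|a x _ [c ->]].
- exists (fun j => (j == i)%:R); rewrite (bigD1 i) //= eqxx scale1r.
  by rewrite big1 ?addr0 // => j /negbTE ->; rewrite scale0r.
- by exists (fun=> 0); rewrite big1 // => i _; rewrite scale0r.
- exists (fun i => c i + c' i); rewrite -big_split /=.
  by apply: eq_bigr => i _; rewrite scalerDl.
- exists (fun i => a * c i); rewrite scaler_sumr.
  by apply: eq_bigr => i _; rewrite scalerA.
Qed.

Lemma functional_sum (kappa : M -> k) (I : finType) (c : I -> k) (v : I -> M) :
  {morph kappa : x y / x + y} -> (forall a x, kappa (a *: x) = a * kappa x) ->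
  kappa (\sum_i c i *: v i) = \sum_i c i * kappa (v i).
Proof.
move=> kD kZ; rewrite (big_morph kappa kD (id1 := 0)); first by apply: eq_bigr.
by rewrite -(scale0r 0) kZ mul0r.
Qed.

End Span.

Lemma span_image (k : comNzRingType) (M N : lmodType k) (f : M -> N)
    (S : M -> Prop) (S' : N -> Prop) m :
  f 0 = 0 -> {morph f : x y / x + y} -> (forall c x, f (c *: x) = c *: f x) ->
  (forall x, S x -> span S' (f x)) -> span S m -> span S' (f m).
Proof.
move=> f0 fD fZ Sf; elim=> {m} [x /Sf //||x y _ Sx _ Sy|c x _ Sx].
- by rewrite f0; apply: span_zero.
- by rewrite fD; apply: span_add.
- by rewrite fZ; apply: span_scale.
Qed.

(** Words are built letter by letter on the right, which matches algebras acting
from the right. *)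
Lemma freeAlg_ind (k : comNzRingType) (X : choiceType)
    (P : freeAlg k X -> Prop) :
  P 0 -> P 1 -> (forall a b, P a -> P b -> P (a + b)) ->
  (forall c a, P a -> P (c *: a)) ->
  (forall a x, P a -> P (a * free_gen k x)) -> forall a, P a.
Proof.
move=> P0 P1 PD PZ PM a.
have Pw (s : seq X) : P (<< FMonom s >> : {malg k[{fmonom X}]}).
  elim/last_ind: s => [|s x IH].
    suff ->: FMonom [::] = mone :> {fmonom X} by [].
    by apply/eqP; rewrite fmP fm1.
  suff ->: (<< FMonom (rcons s x) >> : {malg k[{fmonom X}]})
    = (<< FMonom s >> : freeAlg k X) * free_gen k x by exact: PM.
  rewrite [RHS](_ : _ = (<< FMonom s >> : {malg k[{fmonom X}]}) * << fmu x >>) //.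
  rewrite malgM_def fgmulUU mulr1; congr << _ >>.
  by apply/eqP; rewrite fmP fmM fmU cats1.
rewrite [a](monalgE (a : {malg k[{fmonom X}]})).
elim/big_ind: _ => // w _.
set c := _@__; have ->: (<< c *g w >> : {malg k[{fmonom X}]})
    = c *: (<< FMonom w >> : freeAlg k X).
  rewrite free_scaleE; apply/malgP => v.
  by rewrite mcoeffZ !mcoeffU fmK mulr_natr.
exact: PZ.
Qed.

Lemma quotAlg_ind (k : comNzRingType) (X : choiceType)
    (rel : freeAlg k X -> Prop) (P : quotAlg rel -> Prop) :
  P 0 -> P 1 -> (forall a b, P a -> P b -> P (a + b)) ->
  (forall c a, P a -> P (c *: a)) ->
  (forall a x, P a -> P (a * quot_pi rel (free_gen k x))) -> forall a, P a.
Proof.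
move=> P0 P1 PD PZ PM u; case: (quot_pi_surj u) => a ->.
elim/freeAlg_ind: a => [|| a b Pa Pb|c a Pa|a x Pa].
- by rewrite rmorph0.
- by rewrite rmorph1.
- by rewrite rmorphD; apply: PD.
- by rewrite quot_piZ; apply: PZ.
- by rewrite rmorphM; apply: PM.
Qed.

Lemma quot_pi_rel (k : comNzRingType) (A : kalg k) (rel : A -> Prop) x y :
  rel (x - y) -> quot_pi rel x = quot_pi rel y.
Proof.
move=> r; apply/eqP; rewrite -subr_eq0 -rmorphB; apply/eqP/quot_pi_eq0.
exact: ideal_gen.
Qed.

(** * Tensor powers of a Frobenius algebra *)

Section PureTensors.
Variables (k : comNzRingType) (F : algType k) (n : nat).
Implicit Types (f : {ffun 'I_n -> F}) (i j : 'I_n) (p q : 'S_n).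
Implicit Types (t : tensorPower F n).

Lemma pure_tensorD f i a b :
  pure_tensor (set_factor f i (a + b))
  = pure_tensor (set_factor f i a) + pure_tensor (set_factor f i b).
Proof. by rewrite -rmorphD; apply/quot_pi_rel/tensor_add. Qed.

Lemma pure_tensorZ f i c a :
  pure_tensor (set_factor f i (c *: a)) = c *: pure_tensor (set_factor f i a).
Proof. by rewrite -quot_piZ; apply/quot_pi_rel/tensor_scale. Qed.

Lemma pure_tensor_sum f i (I : finType) (c : I -> k) (v : I -> F) :
  pure_tensor (set_factor f i (\sum_a c a *: v a))
  = \sum_a c a *: pure_tensor (set_factor f i (v a)).
Proof.
under [RHS]eq_bigr do rewrite -pure_tensorZ.
apply: (big_morph (fun x => pure_tensor (set_factor f i x))).
  exact: pure_tensorD.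
by rewrite -(scale0r (0 : F)) pure_tensorZ scale0r.
Qed.

Lemma pure_tensorM f f' :
  pure_tensor f * pure_tensor f' = pure_tensor [ffun i => f i * f' i].
Proof. by rewrite -rmorphM; apply/quot_pi_rel/tensor_mul. Qed.

Lemma pure_tensor1 : pure_tensor [ffun => 1] = 1 :> tensorPower F n.
Proof. by rewrite -[RHS](rmorph1 (quot_pi _)); apply/quot_pi_rel/tensor_one. Qed.

Lemma pure_tensor_span t : span (fun x => exists f, x = pure_tensor f) t.
Proof.
elim/quotAlg_ind: t => [|| t t'|c t|t f St].
- exact: span_zero.
- by apply: span_gen; exists [ffun => 1]; rewrite pure_tensor1.
- exact: span_add.
- exact: span_scale.
pose g (x : tensorPower F n) : tensorPower F n := x * pure_tensor f.
apply: (span_image (f := g)) St; rewrite /g.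
- exact: mul0r.
- by move=> x y; rewrite mulrDl.
- by move=> c x; rewrite kscaleAl.
- move=> _ [f' ->]; apply: span_gen.
  by exists [ffun i => f' i * f i]; rewrite pure_tensorM.
Qed.

Lemma tensor_eq (N : lmodType k) (g h : tensorPower F n -> N) :
  {morph g : x y / x + y} -> {morph h : x y / x + y} ->
  (forall c x, g (c *: x) = c *: g x) -> (forall c x, h (c *: x) = c *: h x) ->
  (forall f, g (pure_tensor f) = h (pure_tensor f)) -> g =1 h.
Proof.
move=> gD hD gZ hZ gh t.
elim: (pure_tensor_span t) => {t} [_ [f ->]|| x y _ Ex _ Ey|c x _ Ex] //.
- by rewrite -(scale0r 0) gZ hZ !scale0r.
- by rewrite gD hD Ex Ey.
- by rewrite gZ hZ Ex.
Qed.

Lemma tensor_perm1 t : tensor_perm 1 t = t.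
Proof.
move: t; apply: tensor_eq => //; first exact: rmorphD.
  exact: tensor_permZ.
move=> f; rewrite tensor_perm_pure; congr pure_tensor.
by apply/ffunP => i; rewrite ffunE invg1 perm1.
Qed.

Lemma tensor_permM p q t :
  tensor_perm p (tensor_perm q t) = tensor_perm (q * p)%g t.
Proof.
move: t; apply: tensor_eq; try exact: rmorphD.
- by move=> x y; rewrite !rmorphD.
- by move=> c x; rewrite !tensor_permZ.
- exact: tensor_permZ.
move=> f; rewrite !tensor_perm_pure; congr pure_tensor.
by apply/ffunP => i; rewrite !ffunE invMg permM.
Qed.

Lemma mul_factor_pure i a f :
  (factor_at i a : tensorPower F n) * pure_tensor f
  = pure_tensor (set_factor f i (a * f i)).
Proof.
rewrite pure_tensorM; congr pure_tensor; apply/ffunP => j.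
by rewrite !ffunE; case: eqP => [->|]; rewrite ?mul1r.
Qed.

Lemma mul_pure_factor i a f :
  pure_tensor f * (factor_at i a : tensorPower F n)
  = pure_tensor (set_factor f i (f i * a)).
Proof.
rewrite pure_tensorM; congr pure_tensor; apply/ffunP => j.
by rewrite !ffunE; case: eqP => [->|]; rewrite ?mulr1.
Qed.

Lemma center_tensorC t t' : center_tensor t -> t * t' = t' * t.
Proof.
move=> Zt; move: t'; apply: tensor_eq.
- by move=> x y; rewrite mulrDr.
- by move=> x y; rewrite mulrDl.
- by move=> c x; rewrite kscaleAr.
- by move=> c x; rewrite kscaleAl.
move=> f; elim: Zt => [_ [z Zz ->]||x y _ Ex _ Ey|c x _ Ex].
- rewrite !pure_tensorM; congr pure_tensor; apply/ffunP => i.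
  by rewrite !ffunE Zz.
- by rewrite mul0r mulr0.
- by rewrite mulrDl mulrDr Ex Ey.
- by rewrite -kscaleAl -kscaleAr Ex.
Qed.

End PureTensors.

Section Frobenius.
Variables (k : comNzRingType) (F : algType k) (tr : {scalar F}).
Variables (I : finType) (B Bdual : I -> F).
Hypotheses (tr_frob : frobenius_trace tr) (tr_sym : symmetric_trace tr).
Hypotheses (B_basis : is_basis B) (B_dual : dual_basis tr B Bdual).

Lemma basis_expand x : x = \sum_c tr (Bdual c * x) *: B c.
Proof.
have [c Ex] := B_basis.1 x; rewrite [LHS]Ex; apply: eq_bigr => a _; congr (_ *: _).
rewrite Ex mulr_sumr linear_sum (bigD1 a) //= -scalerAr linearZ /= B_dual eqxx.
rewrite mulr1 big1 ?addr0 // => b ab.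
by rewrite -scalerAr linearZ /= B_dual eq_sym (negbTE ab) mulr0.
Qed.

Lemma trace_nondegenerate x : (forall g, tr (g * x) = 0) -> x = 0.
Proof.
move=> tx; pose phi0 g : k := tr (g * 0).
have phi0L : scalar phi0 by move=> c a b; rewrite /phi0 !mulr0 !linear0 mulr0 addr0.
pose phi : {scalar F} := HB.pack phi0 (GRing.isLinear.Build _ _ _ _ phi0 phi0L).
have [f [_ f_uniq]] := tr_frob phi.
by rewrite -(f_uniq x) ?(f_uniq 0) // => g; rewrite tx /= /phi0 mulr0 linear0.
Qed.

(** The difference of the two sides is orthogonal to the basis B, hence to F, so
nondegeneracy of the trace kills it. *)
Lemma dual_expand x : x = \sum_b tr (x * B b) *: Bdual b.
Proof.
apply/eqP; rewrite -subr_eq0; apply/eqP/trace_nondegenerate => g.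
rewrite tr_sym [g]basis_expand mulr_sumr linear_sum big1 // => c _.
rewrite -scalerAr linearZ /= mulrBl mulr_suml linearB linear_sum /=.
rewrite (bigD1 c) //= -scalerAl linearZ /= B_dual eqxx mulr1.
rewrite big1 ?addr0 ?subrr ?mulr0 // => b bc.
by rewrite -scalerAl linearZ /= B_dual (negbTE bc) mulr0.
Qed.

(** The Casimir element sum_b b (x) b^vee, seen through an arbitrary bilinear map
beta: left multiplication on one leg can be traded for right multiplication on
the other.  The common value on the right of the next two lemmas yields the
commutation rule of teleporters with tensors. *)
Section Bilinear.
Variables (N : lmodType k) (beta : F -> F -> N).
Hypothesis betal : forall (c : I -> k) (v : I -> F) y,
  beta (\sum_a c a *: v a) y = \sum_a c a *: beta (v a) y.
Hypothesis betar : forall (c : I -> k) (v : I -> F) y,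
  beta y (\sum_a c a *: v a) = \sum_a c a *: beta y (v a).

Lemma casimir_mull x y :
  \sum_b beta (B b * x) (Bdual b * y) = \sum_c beta (B c) (x * Bdual c * y).
Proof.
under eq_bigr => b _ do rewrite [B b * x]basis_expand betal.
rewrite exchange_big /=; apply: eq_bigr => c _; rewrite -betar; congr beta.
rewrite [x * Bdual c]dual_expand mulr_suml; apply: eq_bigr => b _.
by rewrite -scalerAl; congr (_ *: _); rewrite mulrA tr_sym mulrA.
Qed.

Lemma casimir_mulr x y :
  \sum_b beta (y * B b) (x * Bdual b) = \sum_c beta (B c) (x * Bdual c * y).
Proof.
under eq_bigr => b _ do rewrite [y * B b]basis_expand betal.
rewrite exchange_big /=; apply: eq_bigr => c _; rewrite -betar; congr beta.
rewrite -mulrA [Bdual c * y]dual_expand mulr_sumr; apply: eq_bigr => b _.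
by rewrite -scalerAr mulrA.
Qed.

Lemma casimir_swap : \sum_b beta (B b) (Bdual b) = \sum_b beta (Bdual b) (B b).
Proof.
under eq_bigr => b _ do rewrite [in X in beta X _](dual_expand (B b)) betal.
rewrite exchange_big /=; apply: eq_bigr => c _; rewrite -betar; congr beta.
by rewrite [RHS]dual_expand; apply: eq_bigr => b _; rewrite tr_sym.
Qed.

End Bilinear.

Variable n : nat.
Implicit Types (f : {ffun 'I_n -> F}) (i j : 'I_n) (p q : 'S_n).
Implicit Types (t : tensorPower F n).
Let tau := @teleporter k F n I B Bdual.

Let beta f i j x y := pure_tensor (set_factor (set_factor f i x) j y).

Let betal f i j : i != j -> forall (c : I -> k) (v : I -> F) y,
  beta f i j (\sum_a c a *: v a) y = \sum_a c a *: beta f i j (v a) y.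
Proof.
move=> ij c v y.
have E x : set_factor (set_factor f i x) j y = set_factor (set_factor f j y) i x.
  apply/ffunP => l; rewrite !ffunE; case: (eqVneq l j) => [->|] //.
  by rewrite eq_sym (negbTE ij).
by rewrite /beta E pure_tensor_sum; under [RHS]eq_bigr do rewrite E.
Qed.

Let betar f i j (c : I -> k) (v : I -> F) y :
  beta f i j y (\sum_a c a *: v a) = \sum_a c a *: beta f i j y (v a).
Proof. exact: pure_tensor_sum. Qed.

Lemma teleporterE i j : i != j ->
  tau i j = \sum_b beta [ffun => 1] i j (B b) (Bdual b).
Proof.
move=> ij; apply: eq_bigr => b _; rewrite mul_pure_factor.
by rewrite !ffunE eq_sym (negbTE ij) mul1r.
Qed.

Lemma teleporter_sym i j : i != j -> tau i j = tau j i.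
Proof.
move=> ij; have ji : j != i by rewrite eq_sym.
rewrite !teleporterE //.
rewrite (casimir_swap (@betal [ffun => 1] i j ij) (@betar _ i j)).
apply: eq_bigr => b _; congr pure_tensor; apply/ffunP => l; rewrite !ffunE.
by case: (eqVneq l j) => [->|]; rewrite // eq_sym (negbTE ij).
Qed.

Lemma teleporter_perm p i j : tensor_perm p (tau i j) = tau (p i) (p j).
Proof.
rewrite rmorph_sum; apply: eq_bigr => b _; rewrite rmorphM /=.
rewrite /factor_at !tensor_perm_pure !permute_set_factor.
suff -> : permute_tuple p [ffun => 1] = [ffun => 1] :> {ffun 'I_n -> F} by [].
by apply/ffunP => l; rewrite !ffunE.
Qed.

(** Teleporters carry the i-th factor of a tensor to place j and conversely.  On
pure tensors this is [casimir_mull] and [casimir_mulr] for the bilinear map that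
fills places i and j. *)
Lemma teleporterC i j t : i != j ->
  tau i j * t = tensor_perm (tperm i j) t * tau i j.
Proof.
move=> ij; move: t; apply: tensor_eq.
- by move=> x y; rewrite mulrDr.
- by move=> x y; rewrite rmorphD mulrDl.
- by move=> c x; rewrite kscaleAr.
- by move=> c x; rewrite tensor_permZ kscaleAl.
move=> f; rewrite tensor_perm_pure mulr_suml mulr_sumr.
transitivity (\sum_b beta f i j (B b * f i) (Bdual b * f j)).
  apply: eq_bigr => b _; rewrite -mulrA !mul_factor_pure.
  rewrite /beta ffunE (negbTE ij); congr pure_tensor; apply/ffunP => l.
  rewrite !ffunE; case: (eqVneq l j) => [->|] //.
  by rewrite eq_sym (negbTE ij).
rewrite (casimir_mull (@betal f i j ij) (@betar f i j)).
rewrite -(casimir_mulr (@betal f i j ij) (@betar f i j)).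
apply: eq_bigr => b _; rewrite mulrA !mul_pure_factor /beta.
rewrite !ffunE eq_sym (negbTE ij) tpermV tpermL tpermR; congr pure_tensor.
apply/ffunP => l; rewrite !ffunE; case: (eqVneq l j) => // lj.
by case: (eqVneq l i) => // li; rewrite tpermV tpermD // eq_sym.
Qed.

(** Factors are expanded in the basis B one place at a time, by induction on the
list of places that may still hold a vector outside B. *)
Lemma basis_tensor_span t :
  span (fun x => exists b : {ffun 'I_n -> I}, x = pure_tensor [ffun i => B (b i)]) t.
Proof.
apply: span_le (pure_tensor_span t) => _ [f ->].
have: forall i, i \notin enum 'I_n -> exists b, f i = B b.
  by move=> i; rewrite mem_enum.
elim: (enum 'I_n) f => [f fB|i s IH f fB].
  apply: span_gen; have [b Eb] := choice (fun i => fB i isT).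
  by exists (finfun b); congr pure_tensor; apply/ffunP => i; rewrite !ffunE.
have -> : f = set_factor f i (\sum_c tr (Bdual c * f i) *: B c).
  by apply/ffunP => l; rewrite ffunE; case: eqP => // ->; apply: basis_expand.
rewrite pure_tensor_sum; apply: span_sum => c _; apply/span_scale/IH => l ls.
rewrite ffunE; case: eqP => [_|/eqP li]; first by exists c.
by apply: fB; rewrite inE negb_or li.
Qed.

Let N := #|{ffun 'I_n -> I}|.

Let mxAlg : kalg k :=
  @KAlg k 'M[k]_N (@scalar_mx k N) (fun c A => esym (scalar_mxC c A)).

(** A linear form on a presented algebra is obtained from a representation.  Here
it is the tensor power of the right regular representation of F, in matrix form
on the multi-indices; the coordinates of a tensor are those of the row vector of
the unit multiplied by its matrix. *)
Lemma tensor_coord (b : {ffun 'I_n -> I}) :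
  exists kappa : tensorPower F n -> k,
  [/\ {morph kappa : x y / x + y}, forall c t, kappa (c *: t) = c * kappa t
    & forall b' : {ffun 'I_n -> I},
        kappa (pure_tensor [ffun i => B (b' i)]) = (b' == b)%:R].
Proof.
pose coord c x : k := tr (Bdual c * x).
have coordM c x y : coord c (x * y) = \sum_a coord a x * coord c (B a * y).
  rewrite /coord [in LHS](basis_expand x) mulr_suml mulr_sumr linear_sum.
  by apply: eq_bigr => a _; rewrite -scalerAl -scalerAr linearZ.
pose val (r : 'I_N) : {ffun 'I_n -> I} := enum_val r.
have val_bij : bijective val.
  by exists enum_rank => y; rewrite /val ?enum_valK ?enum_rankK.
have coordB (b1 b2 : {ffun 'I_n -> I}) :
    \prod_i coord (b2 i) (B (b1 i)) = (b1 == b2)%:R.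
  under eq_bigr do rewrite /coord B_dual.
  have [->|b12] := eqVneq b1 b2; first by rewrite big1 // => i _; rewrite eqxx.
  have [i Ei] : exists i, b1 i != b2 i.
    apply/existsP; apply: contraNT b12; rewrite negb_exists => /forallP E.
    by apply/eqP/ffunP => i; apply/eqP; move/negbNE: (E i).
  by rewrite (bigD1 i) //= eq_sym (negbTE Ei) mul0r.
pose rho f : mxAlg :=
  \matrix_(r, s) \prod_i coord (val s i) (B (val r i) * f i).
pose rho_hat : {rmorphism freeAlg k {ffun 'I_n -> F} -> mxAlg} := free_lift rho.
have rho_gen f : rho_hat (free_gen k f) = rho f by exact: free_lift_gen.
have rho_Z c a : rho_hat (c *: a) = c *: rho_hat a by exact: free_liftZ.
have mxZ c (M : mxAlg) r s : (c *: M : 'M_N) r s = c * (M : 'M_N) r s.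
  by rewrite kscaleE [LHS](_ : _ = (c%:M *m M) r s) // mul_scalar_mx mxE.
have rho_rel x : tensor_rel x -> rho_hat x = 0.
  case=> [f i a a'|f i c a|f f'|]; rewrite rmorphB;
    apply/eqP; rewrite subr_eq0; apply/eqP.
  - rewrite rmorphD !rho_gen; apply/matrixP => r s; rewrite !mxE.
    rewrite !(bigD1 (P := xpredT) i) //= !ffunE eqxx /coord !mulrDr linearD mulrDl.
    by congr (_ * _ + _ * _); apply: eq_bigr => j /negbTE ji; rewrite !ffunE ji.
  - rewrite rho_Z !rho_gen; apply/matrixP => r s; rewrite mxZ !mxE.
    rewrite !(bigD1 (P := xpredT) i) //= !ffunE eqxx /coord -!scalerAr linearZ -mulrA.
    by congr (_ * (_ * _)); apply: eq_bigr => j /negbTE ji; rewrite !ffunE ji.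
  - rewrite rmorphM !rho_gen; apply/matrixP => r s.
    rewrite [LHS](_ : _ = (rho f *m rho f') r s) // !mxE.
    under [RHS]eq_bigr do rewrite ffunE mulrA coordM.
    rewrite bigA_distr_bigA (reindex val) /=; last exact: onW_bij.
    by apply: eq_bigr => q _; rewrite !mxE -big_split.
  - rewrite rho_gen rmorph1; apply/matrixP => r s; rewrite !mxE.
    under eq_bigr do rewrite ffunE mulr1.
    by rewrite coordB (inj_eq enum_val_inj).
pose phi : tensorPower F n -> 'M_N := quot_lift rho_hat.
have phiE : forall a, phi (quot_pi _ a) = rho_hat a by exact: quot_liftE rho_rel.
pose u r := \prod_i coord (val r i) 1.
exists (fun t => \sum_r u r * phi t r (enum_rank b)); split.
- move=> x y; case: (quot_pi_surj x) (quot_pi_surj y) => a -> [a' ->].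
  rewrite -rmorphD !phiE rmorphD -big_split; apply: eq_bigr => r _.
  by rewrite !mxE mulrDr.
- move=> c t; case: (quot_pi_surj t) => a ->.
  rewrite -quot_piZ !phiE rho_Z mulr_sumr; apply: eq_bigr => r _.
  by rewrite mxZ mulrCA.
move=> b'; under eq_bigr do rewrite phiE rho_gen mxE -big_split.
rewrite -(coordB b' b).
under [RHS]eq_bigr do rewrite -[B _]mul1r coordM.
rewrite bigA_distr_bigA (reindex val) /=; last exact: onW_bij.
apply: eq_bigr => r _; apply: eq_bigr => i _.
by rewrite /val enum_rankK ffunE.
Qed.

End Frobenius.

(** * Wreath data and Jucys-Murphy elements *)

Section WreathData.
Variables (k : comNzRingType) (n : nat) (T : kalg k) (act : 'S_n -> T -> T).

(** An algebra T with an action of the symmetric group and elements t_ij that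
exchange the places i and j.  The combinatorics of the affine wreath product
algebra depends on the tensor power of F through these rules only. *)
Record wreath_data (t : 'I_n -> 'I_n -> T) : Prop := WreathData {
  act_add : forall p, {morph act p : f g / f + g};
  act_mul : forall p, {morph act p : f g / f * g};
  act_scale : forall p c f, act p (c *: f) = c *: act p f;
  act_one : forall f, act 1%g f = f;
  act_comp : forall p q f, act p (act q f) = act (q * p)%g f;
  flip_mul : forall i j f, i != j -> t i j * f = act (tperm i j) f * t i j;
  flip_act : forall p i j, act p (t i j) = t (p i) (p j);
  flip_swap : forall i j, i != j -> t i j = t j i }.

(** Since (q * p)%g is the composite p after q, the map S is multiplicative for
composition of permutations. *)
Record wreath_rep (E : pzRingType) (R : T -> E) (S : 'S_n -> E) : Prop :=
  WreathRep {
  wreath_RM : forall f g, R (f * g) = R f * R g;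
  wreath_S1 : S 1%g = 1;
  wreath_SM : forall p q, S (q * p)%g = S p * S q;
  wreath_SR : forall p f, S p * R f = R (act p f) * S p }.

Record affine_wreath (t : 'I_n -> 'I_n -> T)
    (E : kalg k) (R : T -> E) (S : 'S_n -> E) (X : 'I_n -> E) : Prop :=
  AffineWreath {
  aff_data : wreath_data t;
  aff_rep : wreath_rep R S;
  aff_RD : {morph R : f g / f + g};
  aff_RZ : forall c f, R (c *: f) = c *: R f;
  aff_R1 : R 1 = 1;
  aff_XC : forall i j, X i * X j = X j * X i;
  aff_RX : forall f i, R f * X i = X i * R f;
  aff_SX : forall i i' j : 'I_n, i' = i.+1 :> nat -> j != i -> j != i' ->
    S (tperm i i') * X j = X j * S (tperm i i');
  aff_SXi : forall i i' : 'I_n, i' = i.+1 :> nat ->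
    S (tperm i i') * X i = X i' * S (tperm i i') - R (t i i') }.

End WreathData.

Section JucysMurphy.
Variables (k : comNzRingType) (n : nat) (T : kalg k) (act : 'S_n -> T -> T).
Variables (t : 'I_n -> 'I_n -> T) (tP : wreath_data act t).
Variables (E : pzRingType) (R : T -> E) (S : 'S_n -> E).
Hypothesis RSP : wreath_rep act R S.
Implicit Types (i j l : 'I_n) (p q : 'S_n).

Let RM := wreath_RM RSP.
Let SM := wreath_SM RSP.
Let SR := wreath_SR RSP.

Definition flip i j : E := R (t i j) * S (tperm i j).

Lemma flip_sym i j : i != j -> flip i j = flip j i.
Proof. by move=> ij; rewrite /flip (flip_swap tP) // tpermC. Qed.

(** The exchange of places by t_ij cancels the one by s_ij. *)
Lemma flipR i j f : i != j -> flip i j * R f = R f * flip i j.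
Proof.
move=> ij; rewrite /flip -mulrA SR !mulrA -!RM (flip_mul tP) //.
by rewrite (act_comp tP) tperm2 (act_one tP).
Qed.

Lemma S_flip p i j : S p * flip i j = flip (p i) (p j) * S p.
Proof.
rewrite /flip mulrA SR (flip_act tP) -!mulrA -!SM -tpermJ.
by rewrite conjgE !mulgA mulgV mul1g.
Qed.

Definition jucys i : E := \sum_(j < n | (j < i)%N) flip i j.

Lemma jucysR i f : jucys i * R f = R f * jucys i.
Proof.
rewrite mulr_suml mulr_sumr; apply: eq_bigr => j ji.
by rewrite flipR // neq_ltn ji orbT.
Qed.

Lemma S_jucys p i : (forall j, (j < i)%N = (p j < p i)%N) ->
  S p * jucys i = jucys (p i) * S p.
Proof.
move=> p_mono; rewrite mulr_suml mulr_sumr [RHS](reindex_inj (@perm_inj _ p)).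
apply: eq_big => [j|j _]; last exact: S_flip.
exact: p_mono.
Qed.

(** For j < i the element J_i commutes with T and with the permutations of the
places below i, hence with J_j. *)
Lemma jucysC i j : jucys i * jucys j = jucys j * jucys i.
Proof.
wlog ji : i j / (j < i)%N.
  move=> H; case: (ltngtP i j) => [ij|ji|/val_inj ->] //; last exact: H.
  by symmetry; apply: H.
rewrite {2 3}/jucys mulr_sumr mulr_suml; apply: eq_bigr => l lj.
rewrite /flip mulrA jucysR -!mulrA; congr (_ * _).
have li : (l < i)%N by apply: ltn_trans ji.
have Ei : tperm j l i = i by rewrite tpermD // neq_ltn ?ji ?li.
rewrite [RHS]S_jucys Ei // => m.
by case: tpermP => // ->; rewrite ?ji ?li.
Qed.

Lemma S_jucys_next i i' : i' = i.+1 :> nat ->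
  S (tperm i i') * jucys i = jucys i' * S (tperm i i') - R (t i i').
Proof.
move=> ii'; have ii : (i < i')%N by rewrite ii'.
have ni : i != i' by rewrite neq_ltn ii.
rewrite [jucys i']/jucys (bigD1 (P := fun j : 'I_n => (j < i')%N) i) //= mulrDl.
rewrite {1}/flip -mulrA [tperm i' i]tpermC -SM tperm2 (wreath_S1 RSP) mulr1.
rewrite -(flip_swap tP) // [R _ + _]addrC addrK mulr_suml mulr_sumr.
apply: eq_big => [l|l li]; first by rewrite ii' ltnS andbC ltn_neqAle.
rewrite S_flip tpermL tpermD // neq_ltn ?li ?orbT //.
by rewrite (ltn_trans li) // orbT.
Qed.

Lemma S_jucys_away i i' j : i' = i.+1 :> nat -> j != i -> j != i' ->
  S (tperm i i') * jucys j = jucys j * S (tperm i i').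
Proof.
move=> ii' ji ji'; rewrite [LHS]S_jucys ?tpermD // 1?eq_sym // => l.
have ij : (i < j)%N = (i' < j)%N.
  rewrite ii' [RHS]ltn_neqAle -ii'; case: (i' == j :> nat) / eqP => // E1.
  by move: ji'; rewrite -val_eqE /= -E1 eqxx.
by case: tpermP => // ->; rewrite ij.
Qed.

Variables X Y : 'I_n -> E.
Hypothesis XE : forall i, X i = Y i + jucys i.
Hypothesis SY : forall p i, S p * Y i = Y (p i) * S p.
Hypothesis RY : forall f i, R f * Y i = Y i * R f.

Lemma flipY i j l : flip i j * Y l = Y (tperm i j l) * flip i j.
Proof. by rewrite /flip -mulrA SY mulrA RY mulrA. Qed.

(** For j < i the only summand of J_i that fails to commute with Y_j is u_ij, and
J_j commutes with Y_i.  The right side is antisymmetric in i and j and refers to no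
order on the places: conjugation by a permutation just renames i and j. *)
Lemma commutatorX i j : i != j ->
  X i * X j - X j * X i = Y i * Y j - Y j * Y i + (Y i - Y j) * flip i j.
Proof.
have main i' j' : (j' < i')%N ->
  X i' * X j' - X j' * X i'
  = Y i' * Y j' - Y j' * Y i' + (Y i' - Y j') * flip i' j'.
  move: i' j' => {}i {}j ji.
  have YJ : Y i * jucys j = jucys j * Y i.
    rewrite /jucys mulr_sumr mulr_suml; apply: eq_bigr => l lj.
    have li : (l < i)%N by apply: ltn_trans ji.
    by rewrite flipY tpermD // neq_ltn ?ji ?li.
  have JY : jucys i * Y j = Y j * jucys i + (Y i - Y j) * flip i j.
    rewrite /jucys (bigD1 (P := fun l : 'I_n => (l < i)%N) j) //= mulrDl mulrDr.
    rewrite flipY tpermR mulrBl addrC [Y j * flip i j + _]addrC -addrA.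
    rewrite [Y j * flip i j + _]addrC subrK.
    congr (_ + _); rewrite mulr_suml mulr_sumr; apply: eq_bigr => l /andP[li lj].
    by rewrite flipY tpermD // neq_ltn ?ji ?li ?orbT.
  rewrite !XE !mulrDl !mulrDr JY YJ (jucysC i j).
  set a := Y i * Y j; set b := Y j * Y i; set c := jucys j * Y i.
  set d := Y j * jucys i; set e := jucys j * jucys i; set f := (_ - _) * _.
  rewrite -mulrDl -/f (AC (2*3) ((1*4)*(3*(2*5)))) /= -(addrA b) opprD [LHS]addrACA.
  by rewrite subrr addr0 addrAC.
move=> ij; have [/main //|ji|/val_inj Eij] := ltngtP j i; last first.
  by rewrite Eij eqxx in ij.
by rewrite -opprB main // opprD !mulrBl !opprB (flip_sym ij).
Qed.

End JucysMurphy.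

(** * The algebra of right operators on a module *)

Section RightOperators.
Variables (k : comNzRingType) (V : lmodType k).

(** Operators written on the right: the product g * h applies g first. *)
Record rop := Rop { rop_fun :> V -> V; rop_linear : linear rop_fun }.

HB.instance Definition _ (g : rop) := GRing.isLinear.Build k V V *:%R g (rop_linear g).

Lemma rop_eq (g h : rop) : g =1 h -> g = h.
Proof.
case: g h => [g gL] [h hL] /= /funext gh; case: h / gh hL => hL.
by congr Rop; apply: Prop_irrelevance.
Qed.

HB.instance Definition _ := gen_eqMixin rop.
HB.instance Definition _ := gen_choiceMixin rop.

Fact rop0_linear : linear (fun _ : V => 0 : V).
Proof. by move=> c x y; rewrite scaler0 addr0. Qed.
Fact ropN_linear (g : rop) : linear (fun v => - g v).
Proof. by move=> c x y; rewrite linearP opprD scalerN. Qed.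
Fact ropD_linear (g h : rop) : linear (fun v => g v + h v).
Proof. by move=> c x y; rewrite !linearP scalerDr addrACA. Qed.
Fact rop1_linear : linear (@id V).
Proof. by []. Qed.
Fact ropM_linear (g h : rop) : linear (fun v => h (g v)).
Proof. by move=> c x y; rewrite !linearP. Qed.
Fact ropC_linear (a : k) : linear (fun v : V => a *: v).
Proof. by move=> c x y; rewrite scalerDr !scalerA mulrC. Qed.

Let addA : associative (fun g h => Rop (ropD_linear g h)).
Proof. by move=> f g h; apply: rop_eq => v /=; rewrite addrA. Qed.
Let addC : commutative (fun g h => Rop (ropD_linear g h)).
Proof. by move=> g h; apply: rop_eq => v /=; rewrite addrC. Qed.
Let add0 : left_id (Rop rop0_linear) (fun g h => Rop (ropD_linear g h)).
Proof. by move=> g; apply: rop_eq => v /=; rewrite add0r. Qed.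
Let addN : left_inverse (Rop rop0_linear) (fun g => Rop (ropN_linear g))
  (fun g h => Rop (ropD_linear g h)).
Proof. by move=> g; apply: rop_eq => v /=; rewrite addNr. Qed.
HB.instance Definition _ := GRing.isZmodule.Build rop addA addC add0 addN.

Let mulA : associative (fun g h => Rop (ropM_linear g h)).
Proof. by move=> f g h; apply: rop_eq. Qed.
Let mul1 : left_id (Rop rop1_linear) (fun g h => Rop (ropM_linear g h)).
Proof. by move=> g; apply: rop_eq. Qed.
Let mulr1 : right_id (Rop rop1_linear) (fun g h => Rop (ropM_linear g h)).
Proof. by move=> g; apply: rop_eq. Qed.
Let mulDl : left_distributive (fun g h => Rop (ropM_linear g h)) +%R.
Proof. by move=> f g h; apply: rop_eq => v /=; rewrite linearD. Qed.
Let mulDr : right_distributive (fun g h => Rop (ropM_linear g h)) +%R.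
Proof. by move=> f g h; apply: rop_eq. Qed.
HB.instance Definition _ :=
  GRing.Zmodule_isPzRing.Build rop mulA mul1 mulr1 mulDl mulDr.

Lemma ropDE (g h : rop) v : (g + h) v = g v + h v. Proof. by []. Qed.
Lemma ropNE (g : rop) v : (- g) v = - g v. Proof. by []. Qed.
Lemma ropME (g h : rop) v : (g * h) v = h (g v). Proof. by []. Qed.
Lemma rop_sumE (I : Type) (r : seq I) (P : pred I) (g : I -> rop) v :
  (\sum_(i <- r | P i) g i) v = \sum_(i <- r | P i) g i v.
Proof. by elim/big_rec2: _ => // i x y _ <-. Qed.

Definition rop_scalar (c : k) : rop := Rop (ropC_linear c).
Fact rop_scalar_zmod : zmod_morphism rop_scalar.
Proof. by move=> a b; apply: rop_eq => v /=; rewrite scalerBl. Qed.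
Fact rop_scalar_monoid : monoid_morphism rop_scalar.
Proof.
by split=> [|a b]; apply: rop_eq => v /=; rewrite ?scale1r // scalerA mulrC.
Qed.
HB.instance Definition _ := GRing.isZmodMorphism.Build k rop rop_scalar rop_scalar_zmod.
HB.instance Definition _ :=
  GRing.isMonoidMorphism.Build k rop rop_scalar rop_scalar_monoid.
Fact rop_scalarC c (g : rop) : rop_scalar c * g = g * rop_scalar c.
Proof. by apply: rop_eq => v; rewrite !ropME /= linearZ. Qed.

Definition ropAlg : kalg k := KAlg rop_scalarC.

Lemma rop_scaleE c (g : ropAlg) v : (c *: g : rop) v = c *: (g : rop) v.
Proof. by rewrite kscaleE [LHS](_ : _ = (g : rop) (c *: v)) // linearZ. Qed.

End RightOperators.

(** * A module over the affine wreath product algebra *)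

Section Model.
Variables (k : comNzRingType) (n : nat) (T : kalg k) (act : 'S_n -> T -> T).
Variables (t : 'I_n -> 'I_n -> T) (tP : wreath_data act t).
Implicit Types (i j l a : 'I_n) (p q : 'S_n) (f : T) (g : 'I_n -> nat).

(** Functions of a permutation and an exponent, rather than formal sums of the
corresponding monomials: x_i then acts by shifting the argument, with no case
distinction for the exponent 0. *)
Definition model : lmodType k := 'S_n -> ('I_n -> nat) -> T.
Implicit Types (v : model).

Definition raise g a : 'I_n -> nat := fun l => (g l + (l == a))%N.

Lemma raiseC g a b : raise (raise g a) b = raise (raise g b) a.
Proof. by apply/funext => l; rewrite /raise addnAC. Qed.

Let R0 f v : model := fun p g => v p g * act p f.
Fact model_R_linear f : linear (R0 f).
Proof.
move=> c u v; apply/funext => p; apply/funext => g.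
by rewrite [LHS]mulrDl; congr (_ + _); rewrite -kscaleAl.
Qed.
Definition model_R f : ropAlg model := Rop (model_R_linear f).

Let S0 q v : model := fun p g => v (q^-1 * p)%g g.
Fact model_S_linear q : linear (S0 q).
Proof. by move=> c u v; apply/funext => p; apply/funext => g. Qed.
Definition model_S q : ropAlg model := Rop (model_S_linear q).

Let Y0 i v : model := fun p g =>
  v p (raise g (p i))
    - \sum_(a < n | (p i < a)%N) v (p * tperm a (p i))%g g * t a (p i).
Fact model_Y_linear i : linear (Y0 i).
Proof.
move=> c u v; apply/funext => p; apply/funext => g.
rewrite [RHS](_ : _ = c *: Y0 i u p g + Y0 i v p g) // /Y0.
rewrite scalerBr scaler_sumr addrACA -opprD -big_split; congr (_ - _).
by apply: eq_bigr => a _; rewrite [LHS]mulrDl; congr (_ + _); rewrite kscaleAl.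
Qed.
Definition model_Y i : ropAlg model := Rop (model_Y_linear i).

Lemma model_RE f v p g : (model_R f : rop _) v p g = v p g * act p f.
Proof. by []. Qed.
Lemma model_SE q v p g : (model_S q : rop _) v p g = v (q^-1 * p)%g g.
Proof. by []. Qed.
Lemma model_YE i v p g : (model_Y i : rop _) v p g =
  v p (raise g (p i))
    - \sum_(a < n | (p i < a)%N) v (p * tperm a (p i))%g g * t a (p i).
Proof. by []. Qed.

Lemma model_ext (x y : ropAlg model) :
  (forall v p g, (x : rop _) v p g = (y : rop _) v p g) -> x = y.
Proof. by move=> xy; apply: rop_eq => v; apply/funext => p; apply/funext => g. Qed.

Lemma model_wreath : wreath_rep act model_R model_S.
Proof.
split.
- by move=> f f'; apply: model_ext => v p g; rewrite ropME !model_RE (act_mul tP) mulrA.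
- by apply: model_ext => v p g; rewrite model_SE invg1 mul1g.
- by move=> p q; apply: model_ext => v r g; rewrite ropME !model_SE invMg mulgA.
move=> p f; apply: model_ext => v q g.
rewrite !ropME model_RE !model_SE model_RE (act_comp tP).
by rewrite mulgA mulgV mul1g.
Qed.

(** Equivariance is built into the formula for y_i, which is that of x_i - J_i on
the translates of the functions supported at the identity. *)
Lemma model_SY q i : model_S q * model_Y i = model_Y (q i) * model_S q.
Proof.
apply: model_ext => v p g; rewrite !ropME !(model_SE, model_YE).
rewrite permM permK; congr (_ - _); apply: eq_bigr => a _.
by rewrite model_SE mulgA.
Qed.

Lemma model_RY f i : model_R f * model_Y i = model_Y i * model_R f.
Proof.
apply: model_ext => v p g; rewrite !ropME !(model_RE, model_YE) mulrBl mulr_suml.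
congr (_ - _); apply: eq_bigr => a pia; rewrite model_RE -!mulrA; congr (_ * _).
by rewrite (flip_mul tP) ?(act_comp tP) // neq_ltn pia orbT.
Qed.

Definition model_X i : ropAlg model := model_Y i + jucys t model_R model_S i.

(** Functions supported at the identity permutation; their translates span the
module. *)
Definition embed (w : ('I_n -> nat) -> T) : model :=
  fun p g => if p == 1%g then w g else 0.

Lemma tperm_inv i j p : (tperm i j * p == 1)%g = (p == tperm i j).
Proof. by rewrite -eq_invg_mul tpermV eq_sym. Qed.

Lemma inv_tperm i j p : (p * tperm i j == 1)%g = (p == tperm i j).
Proof. by rewrite -[tperm i j in LHS]tpermV -eq_mulgV1. Qed.

Lemma tperm_source p a i : p = tperm a (p i) -> a != p i -> a = i.
Proof.
move=> Ep; have : p i = tperm a (p i) i by rewrite -Ep.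
by case: tpermP => [//|_ ->|_ ip pii]; rewrite ?eqxx //; case: ip.
Qed.

Lemma tperm_neq1 i j : i != j -> (tperm i j == 1%g) = false.
Proof.
by move=> ij; apply/negP => /eqP E; move: ij; rewrite -(tpermL i j) E perm1 eqxx.
Qed.

(** The correction terms of Y_i and the terms of J_i are supported on the same
transpositions (i, l) with l < i, and cancel there. *)
Lemma model_X_embed i w :
  (model_X i : rop _) (embed w) = embed (fun g => w (raise g i)).
Proof.
apply/funext => p; apply/funext => g.
rewrite ropDE [LHS](_ : _ = (model_Y i : rop _) (embed w) p g
  + (jucys t model_R model_S i : rop _) (embed w) p g) // model_YE.
have -> : (jucys t model_R model_S i : rop _) (embed w) p g
    = \sum_(j < n | (j < i)%N)
        embed w (tperm i j * p)%g g * act (tperm i j * p)%g (t i j).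
  rewrite rop_sumE fct_sumE fct_sumE; apply: eq_bigr => j _.
  by rewrite ropME model_SE model_RE tpermV.
rewrite /embed; have [->|p1] := eqVneq p 1%g.
  rewrite perm1 !big1 ?subr0 ?addr0 // => j ji; rewrite ?mulg1 ?mul1g.
    by rewrite tperm_neq1 ?mul0r // neq_ltn ji orbT.
  by rewrite tperm_neq1 ?mul0r // neq_ltn ji orbT.
rewrite sub0r addrC; apply/eqP; rewrite subr_eq0; apply/eqP.
have [/andP[/eqP Ep pii]|Np] := boolP ((p == tperm i (p i)) && (p i < i)%N).
  have E1 : (tperm i (p i) * p = 1)%g by apply/eqP; rewrite tperm_inv -Ep.
  have E2 : (p * tperm i (p i) = 1)%g by apply/eqP; rewrite inv_tperm -Ep.
  rewrite (bigD1 (P := fun j : 'I_n => (j < i)%N) (p i)) //=.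
  rewrite (bigD1 (P := fun a : 'I_n => (p i < a)%N) i) //=.
  rewrite E1 E2 eqxx (act_one tP) !big1 // => l /andP[lP lN].
    rewrite inv_tperm; case: eqP => [E|]; last by rewrite mul0r.
    by rewrite (tperm_source E) ?eqxx // neq_ltn lP orbT in lN.
  rewrite tperm_inv; case: eqP => [E|]; last by rewrite mul0r.
  by rewrite E tpermL eqxx in lN.
rewrite !big1 // => l lP; rewrite ?inv_tperm ?tperm_inv;
  case: eqP => [E|]; rewrite ?mul0r //.
  have El : l = i by apply: tperm_source E _; rewrite neq_ltn lP orbT.
  by move: Np; rewrite El in E lP; rewrite -E eqxx lP.
by move: Np; rewrite E tpermL lP eqxx.
Qed.

(** The commutator is equivariant by [commutatorX] and vanishes on functions
supported at the identity, hence on all their translates. *)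
Lemma model_XC i j : model_X i * model_X j = model_X j * model_X i.
Proof.
have [->//|ij] := eqVneq i j.
apply/eqP; rewrite -subr_eq0; apply/eqP.
pose D a b := model_X a * model_X b - model_X b * model_X a.
have SD p : model_S p * D i j = D (p i) (p j) * model_S p.
  have pij : p i != p j by rewrite (inj_eq perm_inj).
  have DE := commutatorX tP model_wreath (fun=> erefl) model_SY model_RY.
  rewrite /D !DE // !(mulrDr, mulrDl, mulrBr, mulrBl, mulrN, mulNr).
  have S2 a b : model_S p * (model_Y a * model_Y b)
      = model_Y (p a) * model_Y (p b) * model_S p.
    by rewrite mulrA model_SY -mulrA model_SY mulrA.
  rewrite !S2; congr (_ + (_ - _)).
    by rewrite mulrA model_SY -mulrA (S_flip tP model_wreath) mulrA.
  by rewrite mulrA model_SY -mulrA (S_flip tP model_wreath) mulrA.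
have D1 a b w : (D a b : rop _) (embed w) = 0.
  rewrite ropDE ropNE !ropME !model_X_embed.
  apply/eqP; rewrite subr_eq0; apply/eqP; congr embed; apply/funext => g.
  by rewrite raiseC.
rewrite -/(D i j); apply: rop_eq => v.
(* Decompose v into translates of functions supported at the identity. *)
have -> : v = \sum_p (model_S p : rop _) (embed (v p)).
  apply/funext => p; apply/funext => g; rewrite !fct_sumE (bigD1 p) //=.
  rewrite /S0 mulVg /embed eqxx big1 ?addr0 // => q qp.
  by rewrite /embed -eq_invg_mul invgK (negbTE qp).
rewrite linear_sum big1 // => p _.
by rewrite -[LHS](ropME (model_S p)) SD ropME D1 linear0.
Qed.

Lemma model_affine_wreath : affine_wreath act t model_R model_S model_X.
Proof.
have act_1 p : act p 1 = 1.
  have E : act p (act p^-1%g 1) = 1 by rewrite (act_comp tP) mulVg (act_one tP).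
  by rewrite -[LHS]mulr1 -[X in _ * X]E -(act_mul tP) mul1r E.
split=> //.
- exact: model_wreath.
- move=> f f'; apply: model_ext => v p g.
  by rewrite ropDE [RHS](_ : _ = (model_R f : rop _) v p g
    + (model_R f' : rop _) v p g) // !model_RE (act_add tP) mulrDr.
- move=> c f; apply: model_ext => v p g; rewrite rop_scaleE.
  rewrite [RHS](_ : _ = c *: (model_R f : rop _) v p g) // !model_RE.
  by rewrite (act_scale tP) kscaleAr.
- by apply: model_ext => v p g; rewrite model_RE act_1 mulr1.
- exact: model_XC.
- by move=> f i; rewrite mulrDr mulrDl model_RY (jucysR tP model_wreath).
- move=> i i' j ii' ji ji'; rewrite mulrDr mulrDl model_SY tpermD 1?eq_sym //.
  by rewrite (S_jucys_away tP model_wreath).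
- move=> i i' ii'; rewrite mulrDr mulrDl model_SY tpermL.
  by rewrite (S_jucys_next tP model_wreath) // addrA.
Qed.

Lemma model_expX_embed i m w : (model_X i ^+ m : rop _) (embed w)
  = embed (fun g => w (fun l => (g l + m * (l == i))%N)).
Proof.
elim: m w => [|m IH] w.
  by congr embed; apply/funext => g; congr w; apply/funext => l; rewrite mul0n addn0.
rewrite exprS ropME model_X_embed IH; congr embed; apply/funext => g; congr w.
by apply/funext => l; rewrite /raise mulSn addnAC addnA.
Qed.

Lemma model_prod_embed (r : seq 'I_n) (h : 'I_n -> nat) w :
  (\prod_(i <- r) model_X i ^+ h i : rop _) (embed w)
  = embed (fun g => w (fun l => (g l + \sum_(i <- r) h i * (l == i))%N)).
Proof.
elim: r w => [|i r IH] w.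
  rewrite big_nil; congr embed; apply/funext => g; congr w.
  by apply/funext => l; rewrite big_nil addn0.
rewrite big_cons ropME model_expX_embed IH; congr embed; apply/funext => g.
by congr w; apply/funext => l; rewrite big_cons addnAC addnA.
Qed.

Lemma model_normal_form (h : 'I_n -> nat) f q w p g :
  (\prod_(i < n) model_X i ^+ h i * model_R f * model_S q : rop _) (embed w) p g
  = if q == p then w (fun l => g l + h l)%N * f else 0.
Proof.
rewrite !ropME model_SE model_RE model_prod_embed /embed -eq_invg_mul invgK.
case: eqP => [->|_]; last by rewrite mul0r.
rewrite mulVg (act_one tP); congr (w _ * _); apply/funext => l.
rewrite (bigD1 l) //= eqxx muln1 big1 ?addn0 // => i /negbTE il.
by rewrite eq_sym il muln0.
Qed.

End Model.

(** * Equivariant shifts and the degree filtration *)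

(** The relations between permutations and the x_i are given for adjacent
transpositions only; this spreads their consequences to all permutations. *)
Lemma adjacent_tperm_ind (n : nat) (Q : 'S_n -> Prop) :
  Q 1%g -> (forall p q, Q p -> Q q -> Q (p * q)%g) ->
  (forall i i' : 'I_n, i' = i.+1 :> nat -> Q (tperm i i')) -> forall p, Q p.
Proof.
move=> Q1 QM Qadj.
have Qlt m (i j : 'I_n) : (j = i + m.+1 :> nat)%N -> Q (tperm i j).
  elim: m j => [|m IH] j ij; first by apply: Qadj; rewrite ij addn1.
  have j'n : (i + m.+1 < n)%N by apply: leq_ltn_trans (ltn_ord j); rewrite ij leq_add2l.
  pose j' := Ordinal j'n.
  have Qj : Q (tperm j' j) by apply: Qadj; rewrite ij /= addnS.
  have -> : tperm i j = (tperm j' j * tperm i j' * tperm j' j)%g.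
    rewrite -{1}(tpermV j' j) -mulgA -conjgE tpermJ tpermL tpermD //.
      by rewrite -val_eqE /= neq_ltn addnS ltnS leq_addr orbT.
    by rewrite -val_eqE /= ij neq_ltn addnS ltnS leq_addr orbT.
  by apply/QM => //; apply/QM => //; apply: IH.
have Qt (i j : 'I_n) : Q (tperm i j).
  case: (ltngtP i j) => [ij|ji|/val_inj ->]; last by rewrite tperm1.
    by apply: (Qlt (j - i.+1)%N); rewrite addnS -addSn subnKC.
  by rewrite tpermC; apply: (Qlt (i - j.+1)%N); rewrite addnS -addSn subnKC.
move=> p; case: (prod_tpermP p) => ts -> _.
by elim/big_ind: _.
Qed.

Section AffineWreath.
Variables (k : comNzRingType) (n : nat) (T : kalg k) (act : 'S_n -> T -> T).
Variables (t : 'I_n -> 'I_n -> T) (E : kalg k).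
Variables (R : T -> E) (S : 'S_n -> E) (X : 'I_n -> E).
Hypothesis AP : affine_wreath act t R S X.
Implicit Types (i j l : 'I_n) (p q : 'S_n) (f : T) (a b z : E) (e : nat).

Let tP := aff_data AP.
Let RSP := aff_rep AP.
Let RM := wreath_RM RSP.
Let SM := wreath_SM RSP.
Let SR := wreath_SR RSP.
Let RD := aff_RD AP.
Let XC := aff_XC AP.
Let RX := aff_RX AP.
Let J := jucys t R S.

Definition jm_shift i := X i - J i.
Let Y := jm_shift.

Lemma jm_shift_R f i : R f * Y i = Y i * R f.
Proof. by rewrite mulrBr mulrBl RX (jucysR tP RSP). Qed.

(** The correction term t_ij in the relation for x_i is the one by which J_i fails to
be equivariant. *)
Lemma S_jm_shift p i : S p * Y i = Y (p i) * S p.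
Proof.
elim/adjacent_tperm_ind: p i => [|p q IHp IHq|i i' ii'] j.
- by rewrite (wreath_S1 RSP) perm1 mulr1 mul1r.
- by rewrite SM -mulrA IHp mulrA IHq -mulrA permM.
have SS : S (tperm i i') * S (tperm i i') = 1.
  by rewrite -SM tperm2 (wreath_S1 RSP).
have SYi : S (tperm i i') * Y i = Y i' * S (tperm i i').
  rewrite mulrBr mulrBl (aff_SXi AP) // (S_jucys_next tP RSP) // opprB.
  by rewrite subrKA.
case: tpermP => [->|->|/eqP ji /eqP ji'] //.
  by rewrite -[LHS]mulr1 -SS mulrA -[X in X * _]mulrA -SYi !mulrA SS mul1r.
by rewrite mulrBr mulrBl (aff_SX AP) // (S_jucys_away tP RSP).
Qed.

Lemma S_X p i : S p * X i = X (p i) * S p - J (p i) * S p + S p * J i.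
Proof.
by rewrite -mulrBl -[X (p i) - _]/(Y (p i)) -S_jm_shift -mulrDr subrK.
Qed.

(** The right T S_n-module generated by the x^g chi_l with g of degree less than e,
generated so that the closure properties can be proved by induction.  The strict
bound makes the case d = 0 uniform. *)
Inductive filt (L : Type) (chi : L -> E) : nat -> E -> Prop :=
  | filt_gen x : filt chi 1 (chi x)
  | filt_zero e : filt chi e 0
  | filt_add e a b of filt chi e a & filt chi e b : filt chi e (a + b)
  | filt_S1 e a of filt chi e a : filt chi e.+1 a
  | filt_X e a i of filt chi e a : filt chi e.+1 (X i * a)
  | filt_R e a f of filt chi e a : filt chi e (a * R f)
  | filt_S e a p of filt chi e a : filt chi e (a * S p).

Section Filtration.
Variables (L : Type) (chi : L -> E).
Implicit Types (x : L).

Lemma filt_le e e' a : (e <= e')%N -> filt chi e a -> filt chi e' a.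
Proof.
move=> /subnKC <-; elim: (e' - e)%N => [|m IH] ea; rewrite ?addn0 // addnS.
exact/filt_S1/IH.
Qed.

Lemma filt_scale e c a : filt chi e a -> filt chi e (c *: a).
Proof.
move=> ea; rewrite -[a]mulr1 kscaleAr -(aff_R1 AP) -(aff_RZ AP); exact: filt_R.
Qed.

Lemma filt_opp e a : filt chi e a -> filt chi e (- a).
Proof. by rewrite -scaleN1r; apply: filt_scale. Qed.

Lemma filt_sub e a b : filt chi e a -> filt chi e b -> filt chi e (a - b).
Proof. by move=> ea /filt_opp; apply: filt_add. Qed.

Lemma filt_sum e (I : Type) (r : seq I) (P : pred I) (u : I -> E) :
  (forall y, P y -> filt chi e (u y)) -> filt chi e (\sum_(y <- r | P y) u y).
Proof. by move=> ea; elim/big_ind: _ => //; [apply: filt_zero|apply: filt_add]. Qed.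

Lemma filt_rjucys e a i : filt chi e a -> filt chi e (a * J i).
Proof.
move=> ea; rewrite mulr_sumr; apply: filt_sum => j _.
by rewrite mulrA; apply/filt_S/filt_R.
Qed.

Lemma filt_exprX e a i m : filt chi e a -> filt chi (m + e) (X i ^+ m * a).
Proof.
by move=> ea; elim: m => [|m IH]; rewrite ?expr0 ?mul1r // exprS -mulrA; apply: filt_X.
Qed.

Hypothesis S_chi : forall p x, exists y, S p * chi x = chi y * S p.
Hypothesis R_chi : forall f x, R f * chi x = chi x * R f.

(** Permutations move past x_i at the cost of Jucys-Murphy elements, which have
degree 0 and are absorbed by the induction hypothesis for other f and p. *)
Lemma filt_lRS e a f p : filt chi e a -> filt chi e (R f * S p * a).
Proof.
move=> ea; elim: ea f p => {e a}
  [x|e|e a b _ IHa _ IHb|e a _ IH|e a i _ IH|e a g _ IH|e a q _ IH] f p.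
- have [y Ey] := S_chi p x; rewrite -mulrA Ey mulrA R_chi.
  exact/filt_S/filt_R/filt_gen.
- by rewrite mulr0; apply: filt_zero.
- by rewrite mulrDr; apply: filt_add.
- exact/filt_S1.
- have IHflip j l : filt chi e (flip t R S j l * (R f * S p * a)).
    rewrite /flip -!mulrA [S (tperm _ _) * _]mulrA SR -mulrA.
    rewrite [S (tperm _ _) * _]mulrA -SM.
    by rewrite !mulrA -RM.
  have -> : R f * S p * (X i * a) = X (p i) * (R f * S p * a)
      - J (p i) * (R f * S p * a) + R f * S p * J i * a.
    rewrite [LHS]mulrA -[R f * S p * X i]mulrA S_X mulrDr mulrBr !mulrA RX.
    by rewrite (jucysR tP RSP) mulrDl mulrBl.
  apply: filt_add; first apply: filt_sub; first exact: filt_X.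
    by rewrite mulr_suml; apply/filt_S1/filt_sum => j _.
  rewrite mulr_sumr mulr_suml; apply/filt_S1/filt_sum => j ji.
  have nij : p i != p j by rewrite (inj_eq perm_inj) neq_ltn ji orbT.
  rewrite -(mulrA (R f)) (S_flip tP RSP) mulrA -(flipR tP RSP) // -!mulrA.
  by rewrite [R f * _]mulrA [X in filt _ _ X]mulrA; apply: IHflip.
- by rewrite mulrA; apply: filt_R.
- by rewrite mulrA; apply: filt_S.
Qed.

Lemma filt_lR e a f : filt chi e a -> filt chi e (R f * a).
Proof. by move=> /(filt_lRS f 1%g); rewrite (wreath_S1 RSP) mulr1. Qed.

Lemma filt_lS e a p : filt chi e a -> filt chi e (S p * a).
Proof. by move=> /(filt_lRS 1 p); rewrite (aff_R1 AP) mul1r. Qed.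

Lemma filt_ljucys e a i : filt chi e a -> filt chi e (J i * a).
Proof.
by move=> ea; rewrite mulr_suml; apply: filt_sum => j _; apply: filt_lRS.
Qed.

Hypothesis X_chi : forall i x, filt chi 1 (X i * chi x - chi x * X i).

Lemma filt_rX e a i : filt chi e a -> filt chi e.+1 (a * X i).
Proof.
move=> ea; elim: ea i => {e a}
  [x|e|e a b _ IHa _ IHb|e a _ IH|e a j ea IH|e a f ea IH|e a p ea IH] i.
- rewrite -[_ * X i](subKr (X i * chi x)); apply: filt_sub.
    exact/filt_X/filt_gen.
  exact/filt_S1.
- by rewrite mul0r; apply: filt_zero.
- by rewrite mulrDl; apply: filt_add.
- exact/filt_S1.
- by rewrite -mulrA; apply: filt_X.
- by rewrite -mulrA RX mulrA; apply: filt_R.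
- rewrite -mulrA S_X !mulrDr mulrN !mulrA; apply: filt_add.
    apply: filt_sub; apply: filt_S => //.
    exact/filt_S1/filt_rjucys.
  exact/filt_S1/filt_rjucys/filt_S.
Qed.

(** The degree filtration of the algebra itself, as the case of the family
reduced to 1. *)
Definition filt_one := filt (fun _ : unit => 1).

Lemma filt_rmul e e' z b : filt chi e.+1 z -> filt_one e' b ->
  filt chi (e + e') (z * b).
Proof.
move=> ez e'b; elim: e'b e z ez => {e' b}
  [x|e'|e' a b _ IHa _ IHb|e' a _ IH
  |e' a j _ IH|e' a f _ IH|e' a p _ IH] e z ez.
- by rewrite mulr1 addn1.
- by rewrite mulr0; apply: filt_zero.
- by rewrite mulrDr; apply: filt_add; [apply: IHa|apply: IHb].
- by rewrite addnS; apply/filt_S1/IH.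
- by rewrite mulrA addnS -addSn; apply/IH/filt_rX.
- by rewrite mulrA; apply/filt_R/IH.
- by rewrite mulrA; apply/filt_S/IH.
Qed.

Lemma filt_lmul e e' z b : filt_one e' b -> filt chi e z ->
  filt chi (e' + e) (b * z).
Proof.
move=> e'b; elim: e'b e z => {e' b}
  [x|e'|e' a b _ IHa _ IHb|e' a _ IH
  |e' a j _ IH|e' a f _ IH|e' a p _ IH] e z ez.
- by rewrite mul1r; apply: filt_S1.
- by rewrite mul0r; apply: filt_zero.
- by rewrite mulrDl; apply: filt_add; [apply: IHa|apply: IHb].
- exact/filt_S1/IH.
- by rewrite -mulrA; apply/filt_X/IH.
- by rewrite -mulrA; apply/IH/filt_lR.
- by rewrite -mulrA; apply/IH/filt_lS.
Qed.

Lemma filt_one_chi e b x : filt_one e b -> filt chi e (b * chi x).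
Proof.
move=> eb; elim: eb x => {e b}
  [y|e|e a b _ IHa _ IHb|e a _ IH|e a j _ IH|e a f _ IH|e a p _ IH] x.
- by rewrite mul1r; apply: filt_gen.
- by rewrite mul0r; apply: filt_zero.
- by rewrite mulrDl; apply: filt_add.
- exact/filt_S1.
- by rewrite -mulrA; apply: filt_X.
- by rewrite -mulrA R_chi mulrA; apply: filt_R.
- have [y Ey] := S_chi p x.
  by rewrite -mulrA Ey mulrA; apply: filt_S.
Qed.

End Filtration.
End AffineWreath.

(** * Cyclotomic elements *)

Section Cyclotomic.
Variables (k : comNzRingType) (n : nat) (T : kalg k) (act : 'S_n -> T -> T).
Variables (t : 'I_n -> 'I_n -> T) (E : kalg k).
Variables (R : T -> E) (S : 'S_n -> E) (X : 'I_n -> E).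
Hypothesis AP : affine_wreath act t R S X.
Variables (n_gt0 : (0 < n)%N) (d : nat) (C : 'I_d -> T).
Hypothesis C_comm : forall j f, C j * f = f * C j.
Hypothesis C_inv : forall j p, act p (C j) = C j.
Implicit Types (i j l : 'I_n) (p q : 'S_n) (f : T) (a b z : E) (e : nat).

Let tP := aff_data AP.
Let RSP := aff_rep AP.
Let RM := wreath_RM RSP.
Let SM := wreath_SM RSP.
Let SR := wreath_SR RSP.
Let RD := aff_RD AP.
Let XC := aff_XC AP.
Let RX := aff_RX AP.
Let J := jucys t R S.
Let Y := jm_shift t R S X.
Let i1 := Ordinal n_gt0.

Let filt (chi : 'I_n -> E) := filt R S X chi.
Let fil := filt_one R S X.

(** The conjugates of the cyclotomic relation: for the first index it is the
relation itself, as y_1 = x_1. *)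
Definition cyclo i : E := \prod_(j < d) (Y i - R (C j)).

Lemma S_cyclo p i : S p * cyclo i = cyclo (p i) * S p.
Proof.
rewrite /cyclo; elim/big_ind2: _ => [|a b a' b' IH IH'|j _].
- by rewrite mulr1 mul1r.
- by rewrite mulrA IH -mulrA IH' mulrA.
by rewrite mulrBr mulrBl (S_jm_shift AP) SR C_inv.
Qed.

Lemma R_cyclo f i : R f * cyclo i = cyclo i * R f.
Proof.
rewrite /cyclo; elim/big_ind: _ => [|a b IH IH'|j _]; first by rewrite mulr1 mul1r.
  by rewrite mulrA IH -mulrA IH' mulrA.
by rewrite mulrBr mulrBl (jm_shift_R AP) -!RM C_comm.
Qed.

Lemma jm_shift_first : Y i1 = X i1.
Proof. by rewrite /Y /jm_shift /jucys big_pred0 ?subr0. Qed.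

Lemma X_cyclo_first i : X i * cyclo i1 = cyclo i1 * X i.
Proof.
rewrite /cyclo; elim/big_ind: _ => [|a b IH IH'|j _]; first by rewrite mulr1 mul1r.
  by rewrite mulrA IH -mulrA IH' mulrA.
by rewrite mulrBr mulrBl jm_shift_first XC RX.
Qed.

Let S_chi p x : exists y, S p * cyclo x = cyclo y * S p.
Proof. by exists (p x); apply: S_cyclo. Qed.
Let R_chi f x : R f * cyclo x = cyclo x * R f.
Proof. exact: R_cyclo. Qed.

(** By equivariance it is enough to commute y_a with chi_1, where y_a = x_a - J_a
and x_a commutes with chi_1.  What remains are products of chi_1 with Jucys-Murphy
elements. *)
Lemma X_cyclo i l : filt cyclo 1 (X i * cyclo l - cyclo l * X i).
Proof.
pose p := tperm i1 l.
have pl : p i1 = l by rewrite tpermL.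
have SS : S p * S p = 1 by rewrite -SM tperm2 (wreath_S1 RSP).
have cl : cyclo l = S p * cyclo i1 * S p by rewrite S_cyclo pl -mulrA SS mulr1.
have gen : filt cyclo 1 (cyclo l) by apply: filt_gen.
have XE : X i = Y i + J i by rewrite subrK.
have -> : X i * cyclo l - cyclo l * X i = J i * cyclo l - cyclo l * J i
    - S p * (J (p i) * cyclo i1 - cyclo i1 * J (p i)) * S p.
  have -> : J (p i) * cyclo i1 - cyclo i1 * J (p i)
      = cyclo i1 * Y (p i) - Y (p i) * cyclo i1.
    rewrite /Y /jm_shift mulrBl mulrBr X_cyclo_first opprB.
    by rewrite [RHS]addrC subrKA.
  rewrite {1 2}XE mulrDl mulrDr.
  have -> : Y i * cyclo l = S p * (Y (p i) * cyclo i1) * S p.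
    rewrite cl !mulrA (S_jm_shift AP p (p i)); congr (_ * _ * _ * _).
    by rewrite /p tpermK.
  have -> : cyclo l * Y i = S p * (cyclo i1 * Y (p i)) * S p.
    by rewrite cl -!mulrA -(S_jm_shift AP p i).
  set u := Y (p i) * cyclo i1; set v := cyclo i1 * Y (p i).
  by rewrite mulrBr mulrBl opprB opprD addrACA [LHS]addrC.
apply: (filt_sub AP) => //.
  apply: (filt_sub AP) => //.
    exact: (filt_ljucys AP S_chi R_chi).
  exact: filt_rjucys.
apply/filt_S/(filt_lS AP S_chi R_chi)/(filt_sub AP).
  exact/(filt_ljucys AP S_chi R_chi)/filt_gen.
exact/filt_rjucys/filt_gen.
Qed.

Let filt_one_S p (x : unit) : exists y : unit, S p * 1 = 1 * S p :> E.
Proof. by exists tt; rewrite mulr1 mul1r. Qed.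
Let filt_one_R f (x : unit) : R f * 1 = 1 * R f :> E.
Proof. by rewrite mulr1 mul1r. Qed.

Lemma cyclo_lead l : fil d (cyclo l - X l ^+ d).
Proof.
have lead (r : seq 'I_d) :
    fil (size r) (\prod_(j <- r) (Y l - R (C j)) - X l ^+ size r).
  elim: r => [|c r IH]; first by rewrite big_nil expr0 subrr; apply: filt_zero.
  rewrite big_cons /= exprS; set P := \prod_(j <- r) _ in IH *.
  have filP : fil (size r).+1 P.
    rewrite -[P](subrK (X l ^+ size r)); apply: filt_add; first exact: filt_S1.
    by rewrite -[X l ^+ _]mulr1 -addn1; apply: filt_exprX; apply: (filt_gen _ _ _ _ tt).
  have -> : (Y l - R (C c)) * P - X l * X l ^+ size r
      = X l * (P - X l ^+ size r) - J l * P - R (C c) * P.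
    by rewrite mulrBr /Y /jm_shift !mulrBl [LHS]addrAC [X l * P - J l * P - _]addrAC.
  apply: (filt_sub AP) => //; last exact: (filt_lR AP filt_one_S filt_one_R).
  apply: (filt_sub AP) => //; last exact: (filt_ljucys AP filt_one_S filt_one_R).
  exact: filt_X.
have := lead (index_enum 'I_d).
by rewrite (_ : size (index_enum _) = d) // -[RHS]card_ord cardT enumT.
Qed.

Lemma cyclo_X_expr l i m : filt cyclo m (cyclo l * X i ^+ m - X i ^+ m * cyclo l).
Proof.
elim: m => [|m IH]; first by rewrite mulr1 mul1r subrr; apply: filt_zero.
rewrite exprSr mulrA -(subrK (X i ^+ m * cyclo l * X i) (_ * _)) -addrA -mulrBl.
apply: filt_add.
  exact: (filt_rX AP X_cyclo).
rewrite -!mulrA -mulrBr -addn1; apply: filt_exprX.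
by rewrite -opprB; apply/(filt_opp AP)/X_cyclo.
Qed.

(** Modulo terms of lower degree, both X j ^+ d * cyclo i and X i ^+ d * cyclo j
agree with cyclo i * cyclo j. *)
Lemma cyclo_spair i j :
  filt cyclo d (X j ^+ d * cyclo i - X i ^+ d * cyclo j).
Proof.
have -> : X j ^+ d * cyclo i - X i ^+ d * cyclo j
  = (cyclo i - X i ^+ d) * cyclo j - cyclo i * (cyclo j - X j ^+ d)
    - (cyclo i * X j ^+ d - X j ^+ d * cyclo i).
  rewrite mulrBl mulrBr !opprB [_ - _ + (cyclo i * _ - _)]addrC subrKA.
  by rewrite [RHS]addrC subrKA.
apply: (filt_sub AP); last exact: cyclo_X_expr.
apply: (filt_sub AP); first exact: (filt_one_chi S_chi R_chi _ (cyclo_lead i)).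
exact: (filt_rmul AP X_cyclo (filt_gen _ _ _ _ i) (cyclo_lead j)).
Qed.

End Cyclotomic.

(** * Normal forms modulo the cyclotomic ideal *)

Section Exponents.
Variable n : nat.
Implicit Types (g : {ffun 'I_n -> nat}) (i l : 'I_n) (m : nat).

Definition expo_add g i m : {ffun 'I_n -> nat} := [ffun l => (m * (l == i) + g l)%N].
Definition expo_sub g i m : {ffun 'I_n -> nat} := [ffun l => (g l - m * (l == i))%N].
Definition expo_deg g : nat := (\sum_i g i)%N.

Lemma expo_deg_add g i m : expo_deg (expo_add g i m) = (m + expo_deg g)%N.
Proof.
rewrite /expo_deg; under eq_bigr do rewrite ffunE.
rewrite big_split /= (bigD1 i) //= eqxx muln1 big1 ?addn0 // => l /negbTE ->.
by rewrite muln0.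
Qed.

Lemma expo_addK g i m : expo_sub (expo_add g i m) i m = g.
Proof. by apply/ffunP => l; rewrite !ffunE addnC addnK. Qed.

Lemma expo_subK g i m : (m <= g i)%N -> expo_add (expo_sub g i m) i m = g.
Proof.
move=> mg; apply/ffunP => l; rewrite !ffunE; case: eqP => [->|_].
  by rewrite muln1 subnKC.
by rewrite muln0 subn0.
Qed.

End Exponents.

Section NormalForm.
Variables (k : comNzRingType) (n : nat) (T : kalg k) (act : 'S_n -> T -> T).
Variables (t : 'I_n -> 'I_n -> T) (E : kalg k).
Variables (R : T -> E) (S : 'S_n -> E) (X : 'I_n -> E).
Hypothesis AP : affine_wreath act t R S X.
Implicit Types (i j l : 'I_n) (p q : 'S_n) (f : T) (a b z : E) (e D : nat).
Implicit Types (g : {ffun 'I_n -> nat}).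

Let RSP := aff_rep AP.
Let RM := wreath_RM RSP.
Let SM := wreath_SM RSP.
Let SR := wreath_SR RSP.
Let XC := aff_XC AP.
Let fil := filt_one R S X.

Definition mon g : E := \prod_(i < n) X i ^+ g i.

Lemma mon_add g i m : mon (expo_add g i m) = X i ^+ m * mon g.
Proof.
rewrite /mon; under eq_bigr do rewrite ffunE exprD.
rewrite prodrM_comm; last first.
  by move=> j l _ _; apply: commrX; apply: commr_sym; apply: commrX; apply: XC.
congr (_ * _); transitivity (\prod_(l < n | l == i) X l ^+ m); last first.
  by rewrite big_pred1_eq.
rewrite [RHS]big_mkcond /=; apply: eq_bigr => l _.
by case: (l == i); rewrite ?muln1 ?muln0.
Qed.

Lemma mon_exprC g i m : X i ^+ m * mon g = mon g * X i ^+ m.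
Proof.
apply: commr_sym; apply: commrX; apply: commr_sym; apply: commr_prod => j _.
by apply: commrX; apply: XC.
Qed.

Lemma mon0 : mon [ffun => 0%N] = 1.
Proof. by rewrite /mon big1 // => i _; rewrite ffunE. Qed.

Definition rspan (P : E -> Prop) : E -> Prop :=
  span (fun z => exists a f p, P a /\ z = a * R f * S p).

Lemma rspan_gen (P : E -> Prop) a : P a -> rspan P a.
Proof.
move=> Pa; apply: span_gen; exists a, 1, 1%g; split=> //.
by rewrite (aff_R1 AP) (wreath_S1 RSP) !mulr1.
Qed.

Lemma rspan_RS (P : E -> Prop) z f p : rspan P z -> rspan P (z * R f * S p).
Proof.
move=> Pz; pose h (a : E) : E := a * R f * S p.
apply: (span_image (f := h)) Pz; rewrite /h.
- by rewrite !mul0r.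
- by move=> a b; rewrite !mulrDl.
- by move=> c a; rewrite !kscaleAl.
move=> _ [a [f' [p' [Pa ->]]]]; apply: span_gen.
exists a, (f' * act p' f), (p * p')%g; split=> //.
by rewrite RM SM !mulrA -(mulrA (a * R f')) SR !mulrA.
Qed.

Lemma rspan_le (P Q : E -> Prop) z :
  (forall a, P a -> rspan Q a) -> rspan P z -> rspan Q z.
Proof.
move=> PQ; apply: span_le => _ [a [f [p [/PQ Qa ->]]]]; exact: rspan_RS.
Qed.

Lemma filt_span (L : Type) (chi : L -> E) e z : filt R S X chi e z ->
  rspan (fun a => exists g x, (expo_deg g < e)%N /\ a = mon g * chi x) z.
Proof.
elim=> {e z} [x|e|e a b _ IHa _ IHb|e a _ IH|e a i _ IH|e a f _ IH|e a p _ IH].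
- apply: rspan_gen; exists [ffun => 0%N], x; rewrite mon0 mul1r; split=> //.
  by rewrite /expo_deg big1 // => i _; rewrite ffunE.
- exact: span_zero.
- exact: span_add.
- apply: rspan_le IH => b [g [l [ge ->]]]; apply: rspan_gen; exists g, l.
  by rewrite ltnW.
- pose h (a : E) : E := X i * a.
  apply: (span_image (f := h)) IH; rewrite /h.
  + by rewrite mulr0.
  + by move=> b c; rewrite mulrDr.
  + by move=> c b; rewrite kscaleAr.
  move=> _ [_ [f [p [[g [l [ge ->]]] ->]]]]; rewrite !mulrA; apply/rspan_RS/rspan_gen.
  exists (expo_add g i 1), l; rewrite expo_deg_add add1n ltnS; split=> //.
  by rewrite mon_add.
- by move/(rspan_RS f 1%g): IH; rewrite (wreath_S1 RSP) mulr1.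
- by move/(rspan_RS 1 p): IH; rewrite (aff_R1 AP) mulr1.
Qed.

Lemma filt_one_span e z : fil e z ->
  rspan (fun a => exists2 g, (expo_deg g < e)%N & a = mon g) z.
Proof.
move/filt_span; apply: rspan_le => a [g [_ [ge ->]]].
by rewrite mulr1; apply: rspan_gen; exists g.
Qed.

Lemma filt_mon (L : Type) (chi : L -> E) g e z :
  filt R S X chi e z -> filt R S X chi (expo_deg g + e) (mon g * z).
Proof.
rewrite /mon /expo_deg => ez; elim/big_rec2: _ => [|i m b _ IH]; rewrite ?mul1r //.
by rewrite -mulrA -addnA; apply: filt_exprX.
Qed.

Variables (n_gt0 : (0 < n)%N) (d : nat) (C : 'I_d -> T).
Hypothesis C_comm : forall c f, C c * f = f * C c.
Hypothesis C_inv : forall c p, act p (C c) = C c.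

Let i1 := Ordinal n_gt0.
Let chi := cyclo t R S X C.

Definition reducible g := [exists i, (d <= g i)%N].
Definition pivot g : 'I_n := odflt i1 [pick i | (d <= g i)%N].
(** Among the factors x_i^d of x^g one is singled out and replaced by chi_i. *)
Definition leading g : E := mon (expo_sub g (pivot g) d) * chi (pivot g).

Lemma pivotP g : reducible g -> (d <= g (pivot g))%N.
Proof.
by move=> /existsP[i di]; rewrite /pivot; case: pickP => [//|/(_ i)]; rewrite di.
Qed.

Lemma leadingP g : reducible g -> fil (expo_deg g) (leading g - mon g).
Proof.
move=> /pivotP pg; rewrite /leading; set h := expo_sub _ _ _.
have -> : mon g = mon h * X (pivot g) ^+ d.
  by rewrite -mon_exprC -mon_add expo_subK.
have -> : expo_deg g = (expo_deg h + d)%N.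
  by rewrite addnC -(expo_deg_add _ (pivot g)) expo_subK.
by rewrite -mulrBr; apply/filt_mon/(cyclo_lead AP).
Qed.

Definition reducible_span D : E -> Prop :=
  rspan (fun a => exists2 g, reducible g && (expo_deg g < D)%N & a = leading g).

(** If x^g chi_l is not the element singled out for x^g x_l^d, then it differs from
it by a multiple of the critical pair of l and the pivot, which has lower degree. *)
Lemma filt_cyclo_span e z : filt R S X chi e z -> reducible_span (e + d) z.
Proof.
elim/ltn_ind: e z => e IH z /filt_span; apply: rspan_le => _ [g [l [ge ->]]].
pose g' := expo_add g l d.
have red : reducible g'.
  by apply/existsP; exists l; rewrite ffunE eqxx muln1 leq_addr.
have deg_g' : (expo_deg g' < e + d)%N by rewrite expo_deg_add addnC ltn_add2r.
have gen : reducible_span (e + d) (leading g').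
  by apply: rspan_gen; exists g'; rewrite ?red.
have [El|nl] := eqVneq (pivot g') l.
  by move: gen; rewrite /leading El expo_addK.
set r := pivot g' in nl.
have dr : (d <= g r)%N by move: (pivotP red); rewrite -/r ffunE (negbTE nl) muln0.
pose h := expo_sub g r d.
have Eh : expo_sub g' r d = expo_add h l d.
  apply/ffunP => m; rewrite !ffunE; case: (eqVneq m r) => [->|_].
    by rewrite (negbTE nl) muln0.
  by rewrite muln0 !subn0.
have -> : mon g * chi l = leading g'
    + mon h * (X r ^+ d * chi l - X l ^+ d * chi r).
  rewrite /leading -/r Eh mon_add -(expo_subK dr) mon_add -/h !mon_exprC mulrBr !mulrA.
  by rewrite addrC subrK.
apply: span_add => //.
have deg_h : (expo_deg h + d = expo_deg g)%N.
  by rewrite -[in RHS](expo_subK dr) expo_deg_add addnC.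
apply: rspan_le (IH (expo_deg g) ge _ _).
  move=> _ [g2 /andP[red2 lt2] ->]; apply: rspan_gen; exists g2 => //.
  by rewrite red2 (leq_trans lt2) // leq_add2r ltnW.
by rewrite -deg_h; apply/filt_mon/(cyclo_spair AP).
Qed.

(* The quotient is formed by a predicate, so the relation is fixed up to logical
equivalence only. *)
Variable rel : E -> Prop.
Hypothesis relE : forall a, rel a <-> a = chi i1.
Let cyclo_ideal := ideal_gen_by rel.

Hypothesis fil_total : forall a, exists e, fil e a.

Lemma ideal_filt a : cyclo_ideal a -> exists e, filt R S X chi e a.
Proof.
have chiS p x : exists y, S p * chi x = chi y * S p.
  by exists (p x); apply: (S_cyclo AP).
have chiR f x : R f * chi x = chi x * R f by apply: (R_cyclo AP).
elim=> {a} [_ /relE ->||a b _ [e ea] _ [e' eb]|b a _ [e ea]|b a _ [e ea]].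
- by exists 1%N; apply: filt_gen.
- by exists 0%N; apply: filt_zero.
- exists (e + e')%N; apply: filt_add.
    by apply: filt_le ea; apply: leq_addr.
  by apply: filt_le eb; apply: leq_addl.
- have [e' eb] := fil_total b; exists (e' + e)%N.
  exact: (filt_lmul AP).
- have [e' eb] := fil_total b; exists (e + e')%N.
  by apply: (filt_rmul AP) => //; [apply: (X_cyclo AP)|apply: filt_S1].
Qed.

Lemma cyclo_in_ideal i : cyclo_ideal (chi i).
Proof.
have -> : chi i = S (tperm i1 i) * chi i1 * S (tperm i1 i).
  rewrite (S_cyclo AP) // tpermL -mulrA -SM tperm2 (wreath_S1 RSP) mulr1.
  by [].
by apply/ideal_mulr/ideal_mull/ideal_gen/relE.
Qed.

Lemma ideal_scale c a : cyclo_ideal a -> cyclo_ideal (c *: a).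
Proof. by rewrite kscaleE; apply: ideal_mull. Qed.

(** Subtracting the leading element of a reducible monomial lowers the degree. *)
Lemma reduce a : exists2 w,
  rspan (fun a => exists2 g, ~~ reducible g & a = mon g) w & cyclo_ideal (a - w).
Proof.
have [e] := fil_total a; elim/ltn_ind: e a => e IH a /filt_one_span.
elim=> {a} [_ [_ [f [p [[g ge ->] ->]]]]||a b _ [w Sw Ia] _ [w' Sw' Ib]
  |c a _ [w Sw Ia]].
- have [red|irr] := boolP (reducible g); last first.
    exists (mon g * R f * S p); last by rewrite subrr; apply: ideal_zero.
    by apply/rspan_RS/rspan_gen; exists g.
  have fil_g : fil (expo_deg g) ((mon g - leading g) * R f * S p).
    apply/filt_S/filt_R; rewrite -opprB; exact/(filt_opp AP)/leadingP.
  have [w Sw Iw] := IH _ ge _ fil_g; exists w => //.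
  rewrite -[mon g](subrK (leading g)) !mulrDl addrAC.
  apply: ideal_add; first by rewrite -!mulrDl.
  by apply/ideal_mulr/ideal_mulr/ideal_mull/cyclo_in_ideal.
- by exists 0; [apply: span_zero|rewrite subrr; apply: ideal_zero].
- exists (w + w'); first exact: span_add.
  by rewrite opprD addrACA; apply: ideal_add.
- by exists (c *: w); [apply: span_scale|rewrite -scalerBr; apply: ideal_scale].
Qed.

Variable kap : {ffun 'I_n -> nat} -> 'S_n -> E -> T.
Hypothesis kapD : forall g p, {morph kap g p : a b / a + b}.
Hypothesis kapZ : forall g p c a, kap g p (c *: a) = c *: kap g p a.
Hypothesis kapE : forall g p g' f q,
  kap g p (mon g' * R f * S q) = if (g' == g) && (q == p) then f else 0.

Lemma kap_fil g p e z : fil e z -> (e <= expo_deg g)%N -> kap g p z = 0.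
Proof.
move=> /filt_one_span ez ge.
elim: ez => {z} [_ [_ [f [q [[g' g'e ->] ->]]]]||a b _ Ea _ Eb|c a _ Ea].
- rewrite kapE; case: eqP => // Eg; move: g'e; by rewrite Eg ltnNge ge.
- by rewrite -(scale0r 0) kapZ scale0r.
- by rewrite kapD Ea Eb addr0.
- by rewrite kapZ Ea scaler0.
Qed.

(** Leading elements have the coordinates of their leading monomials in top degree,
as the rest has lower degree. *)
Lemma kap_leading g p g' f q : reducible g' -> (expo_deg g' <= expo_deg g)%N ->
  kap g p (leading g' * R f * S q) = if (g' == g) && (q == p) then f else 0.
Proof.
move=> red le; rewrite -[leading g'](subrK (mon g')) !mulrDl kapD kapE.
rewrite (@kap_fil _ _ (expo_deg g')) ?add0r // -!mulrDl.
exact/filt_S/filt_R/leadingP.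
Qed.

Let expand D (h : {ffun 'I_n -> 'I_D.+1}) : {ffun 'I_n -> nat} := [ffun i => h i : nat].

(** The part of top degree D of an element of the span of the leading elements. *)
Definition layer D z : E :=
  \sum_(h : {ffun 'I_n -> 'I_D.+1} | reducible (expand h) && (expo_deg (expand h) == D))
    \sum_p leading (expand h) * R (kap (expand h) p z) * S p.

Lemma top_layer D z : reducible_span D.+1 z -> reducible_span D (z - layer D z).
Proof.
have R0 : R 0 = 0 by rewrite -(scale0r 0) (aff_RZ AP) scale0r.
have kap0 g p : kap g p 0 = 0 by rewrite -(scale0r 0) kapZ scale0r.
have layer0 : layer D 0 = 0.
  by rewrite /layer big1 // => h _; rewrite big1 // => p _; rewrite kap0 R0 mulr0 mul0r.
have layerD : {morph layer D : a b / a + b}.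
  move=> a b; rewrite /layer -big_split; apply: eq_bigr => h _.
  by rewrite -big_split; apply: eq_bigr => p _; rewrite kapD (aff_RD AP) mulrDr mulrDl.
have layerZ c a : layer D (c *: a) = c *: layer D a.
  rewrite /layer scaler_sumr; apply: eq_bigr => h _.
  rewrite scaler_sumr; apply: eq_bigr => p _.
  by rewrite kapZ (aff_RZ AP) -kscaleAr -kscaleAl.
move=> Sz; apply: (span_image (f := fun a => a - layer D a)) Sz.
- by rewrite layer0 subr0.
- by move=> a b; rewrite layerD opprD addrACA.
- by move=> c a; rewrite layerZ scalerBr.
move=> _ [_ [f [p [[g0 /andP[red]] + ->] ->]]].
rewrite ltnS leq_eqVlt => /orP[/eqP Dg0|ltD]; last first.
  rewrite /layer big1 ?subr0.
    by apply/rspan_RS/rspan_gen; exists g0; rewrite // red.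
  move=> h /andP[_ /eqP Dh]; rewrite big1 // => q _.
  rewrite kap_leading ?Dh ?(ltnW ltD) //.
  case: eqP => [Eg|_]; last by rewrite R0 mulr0 mul0r.
  by move: ltD; rewrite Eg Dh ltnn.
have g0D i : (g0 i < D.+1)%N by rewrite ltnS -Dg0 /expo_deg (bigD1 i) //= leq_addr.
pose h0 := [ffun i => Ordinal (g0D i)].
have Eh0 : expand h0 = g0 by apply/ffunP => i; rewrite !ffunE.
suff -> : layer D (leading g0 * R f * S p) = leading g0 * R f * S p.
  by rewrite subrr; apply: span_zero.
rewrite /layer (bigD1 h0) /= ?Eh0 ?red ?Dg0 ?eqxx // [X in _ + X]big1 ?addr0.
  rewrite (bigD1 p) //= kap_leading ?Dg0 // !eqxx big1 ?addr0 // => q /negbTE qp.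
  by rewrite kap_leading // eqxx eq_sym qp R0 mulr0 mul0r.
move=> h /andP[/andP[_ /eqP Dh] hh0]; rewrite big1 // => q _.
rewrite kap_leading ?Dg0 ?Dh //.
case: eqP => [Eg|_]; last by rewrite R0 mulr0 mul0r.
case/eqP: hh0; apply/ffunP => i; apply: val_inj; rewrite ffunE /= Eg.
by rewrite ffunE.
Qed.

(** The layers are removed from the top; each of them is zero, since it is computed
from coordinates at reducible exponents. *)
Lemma ideal_reduced z : cyclo_ideal z ->
  (forall g p, reducible g -> kap g p z = 0) -> z = 0.
Proof.
move=> /ideal_filt[e /filt_cyclo_span] + kz; elim: (e + d)%N => [|D IH].
  move=> Sz; clear kz; elim: Sz => // [x [y [f [p [[g]]]]]|a b _ -> _ ->|c a _ ->].
  - by rewrite ltn0 andbF.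
  - by rewrite addr0.
  - by rewrite scaler0.
move/top_layer; rewrite /layer big1 ?subr0 // => h /andP[red _].
rewrite big1 // => p _; rewrite kz //.
by rewrite -(scale0r 0) (aff_RZ AP) scale0r mulr0 mul0r.
Qed.

Definition expo_of (alpha : {ffun 'I_n -> 'I_d}) : {ffun 'I_n -> nat} :=
  [ffun i => alpha i : nat].

Lemma mon_expo_of alpha : mon (expo_of alpha) = \prod_(i < n) X i ^+ alpha i.
Proof. by apply: eq_bigr => i _; rewrite ffunE. Qed.

(** The coordinates kap of an element at the exponents below d recover its
coefficients, and no other coordinate occurs in a combination of the proposed basis. *)
Theorem cyclo_basis (K : finType) (v : K -> T) : is_basis v ->
  is_basis (fun e : {ffun 'I_n -> 'I_d} * K * 'S_n =>
    quot_pi rel (mon (expo_of e.1.1) * R (v e.1.2) * S e.2)).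
Proof.
move=> [v_span v_free].
have R0 : R 0 = 0 by rewrite -(scale0r 0) (aff_RZ AP) scale0r.
split=> [m|c cv].
  case: (quot_pi_surj m) => a ->; have [w Sw Iw] := reduce a.
  have -> : quot_pi rel a = quot_pi rel w.
    by apply/eqP; rewrite -subr_eq0 -rmorphB; apply/eqP/quot_pi_eq0.
  apply: span_family; apply: (span_image (f := quot_pi rel)) Sw.
  - exact: rmorph0.
  - by move=> x y; rewrite rmorphD.
  - by move=> b x; rewrite quot_piZ.
  move=> _ [_ [f [p [[g irr ->] ->]]]]; have [b ->] := v_span f.
  rewrite (big_morph R (aff_RD AP) R0) mulr_sumr mulr_suml rmorph_sum /=.
  apply: span_sum => y _; rewrite (aff_RZ AP). rewrite -kscaleAr -kscaleAl quot_piZ.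
  apply/span_scale/span_gen.
  have gd i : (g i < d)%N by move: irr; rewrite negb_exists ltnNge => /forallP.
  exists ([ffun i => Ordinal (gd i)], y, p); congr (quot_pi _ (mon _ * _ * _)).
  by apply/ffunP => i; rewrite !ffunE.
pose u := \sum_(e : {ffun 'I_n -> 'I_d} * K * 'S_n)
  c e *: (mon (expo_of e.1.1) * R (v e.1.2) * S e.2).
have kapu g p : kap g p u = \sum_(e : {ffun 'I_n -> 'I_d} * K * 'S_n
    | (expo_of e.1.1 == g) && (e.2 == p)) c e *: v e.1.2.
  have kap0 : kap g p 0 = 0 by rewrite -(scale0r 0) kapZ scale0r.
  rewrite /u (big_morph (kap g p) (kapD g p) kap0) [RHS]big_mkcond.
  by apply: eq_bigr => e _; rewrite kapZ kapE; case: ifP; rewrite ?scaler0.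
have u0 : u = 0.
  apply: ideal_reduced.
    apply/quot_pi_eq0; rewrite rmorph_sum -[RHS]cv /=.
    by apply: eq_bigr => e _; rewrite quot_piZ.
  move=> g p /existsP[i di]; rewrite kapu big_pred0 // => e; apply/negbTE.
  apply/negP => /andP[/eqP Eg _]; move: di; rewrite -Eg ffunE.
  by rewrite leqNgt ltn_ord.
move=> [[alpha y] p].
have := kapu (expo_of alpha) p; rewrite u0 -(scale0r 0) kapZ scale0r.
rewrite (reindex (fun x => (alpha, x, p))) /=; last first.
  exists (fun r => r.1.2) => [x _ //|[[beta x] q]].
  rewrite inE /= => /andP[/eqP Eb /eqP ->]; congr (_, _, _).
  apply/ffunP => i; apply: val_inj; move/ffunP: Eb => /(_ i).
  by rewrite !ffunE.
rewrite (eq_bigl xpredT) => [/esym/v_free/(_ y) //|x]; by rewrite !eqxx.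
Qed.

End NormalForm.

(** * The presented algebra: universal property and coordinates *)

Section Presentation.
Variables (k : comNzRingType) (F : algType k) (n : nat).
Variables (I : finType) (B Bdual : I -> F).
Local Notation T := (tensorPower F n).
Let t := @teleporter k F n I B Bdual.
Hypothesis tP : wreath_data (@tensor_perm k F n) t.

Let A := @awpa k F n I B Bdual.
Let R : T -> A := @awpa_tensor k F n I B Bdual.
Let S : 'S_n -> A := @awpa_perm k F n I B Bdual.
Let X : 'I_n -> A := @awpa_x k F n I B Bdual.

Lemma awpa_wreath_rep : wreath_rep (@tensor_perm k F n) R S.
Proof.
split.
- by move=> f g; rewrite /R /awpa_tensor -rmorphM; apply/quot_pi_rel/awpa_fM.
- by rewrite -[RHS](rmorph1 (quot_pi _)); apply/quot_pi_rel/awpa_p1.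
- by move=> p q; rewrite /S /awpa_perm -rmorphM; apply/quot_pi_rel/awpa_pM.
- move=> p f; rewrite /R /S /awpa_tensor /awpa_perm -!rmorphM.
  exact/quot_pi_rel/awpa_pf.
Qed.

Lemma awpa_affine_wreath : affine_wreath (@tensor_perm k F n) t R S X.
Proof.
split; first exact: tP.
- exact: awpa_wreath_rep.
- by move=> f g; rewrite /R /awpa_tensor -rmorphD; apply/quot_pi_rel/awpa_fD.
- by move=> c f; rewrite /R /awpa_tensor -quot_piZ; apply/quot_pi_rel/awpa_fZ.
- by rewrite -[RHS](rmorph1 (quot_pi _)); apply/quot_pi_rel/awpa_f1.
- by move=> i j; rewrite /X /awpa_x -!rmorphM; apply/quot_pi_rel/awpa_xx.
- move=> f i; rewrite /X /R /awpa_x /awpa_tensor -!rmorphM.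
  exact/quot_pi_rel/awpa_fx.
- move=> i i' j ii' ji ji'; rewrite /X /S /awpa_x /awpa_perm -!rmorphM.
  exact/quot_pi_rel/(awpa_sx _ _ ii' ji ji').
- move=> i i' ii'; rewrite /X /S /R /awpa_x /awpa_perm /awpa_tensor -!rmorphM -rmorphB.
  exact/quot_pi_rel/awpa_sxi.
Qed.

Lemma awpa_total a : exists e, filt_one R S X e a.
Proof.
elim/quotAlg_ind: a => [||a b [e ea] [e' eb]|c a [e ea]|a [[i|f]|p] [e ea]].
- by exists 0%N; apply: filt_zero.
- by exists 1%N; apply: (filt_gen _ _ _ _ tt).
- exists (e + e')%N; apply: filt_add.
    by apply: filt_le ea; apply: leq_addr.
  by apply: filt_le eb; apply: leq_addl.
- by exists e; apply: (filt_scale awpa_affine_wreath).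
- exists e.+1; apply: (filt_rX awpa_affine_wreath) ea => j y.
  by rewrite mulr1 mul1r subrr; apply: filt_zero.
- by exists e; apply: filt_R.
- by exists e; apply: filt_S.
Qed.

Section UniversalProperty.
Variables (E : kalg k) (R' : T -> E) (S' : 'S_n -> E) (X' : 'I_n -> E).
Hypothesis AP : affine_wreath (@tensor_perm k F n) t R' S' X'.

Let on_gen (x : 'I_n + T + 'S_n) : E :=
  match x with inl (inl i) => X' i | inl (inr f) => R' f | inr p => S' p end.

(** The hypotheses collected in [affine_wreath] are the defining relations, read
in E, so this is the universal property of the presentation. *)
Lemma awpa_lift : exists phi : {rmorphism A -> E},
  [/\ forall c a, phi (c *: a) = c *: phi a, forall i, phi (X i) = X' i,
      forall f, phi (R f) = R' f & forall p, phi (S p) = S' p].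
Proof.
have [hat hatZ hatE] : exists2 hat : {rmorphism freeAlg k ('I_n + T + 'S_n)%type -> E},
    forall c a, hat (c *: a) = c *: hat a & forall x, hat (free_gen k x) = on_gen x.
  exists (free_lift on_gen : {rmorphism _ -> _}); first exact: free_liftZ.
  exact: free_lift_gen.
have hat_rel x : awpa_rel B Bdual x -> hat x = 0.
  have RSP := aff_rep AP.
  case=> [i j|f g|c f|f g||p q||f i|i i' j ii' ji ji'|i i' ii'|p f];
    rewrite rmorphB; apply/eqP; rewrite subr_eq0; apply/eqP.
  - by rewrite [LHS]rmorphM [RHS]rmorphM !hatE; apply: (aff_XC AP).
  - by rewrite [RHS]rmorphD !hatE; apply: (aff_RD AP).
  - by rewrite [RHS]hatZ !hatE; apply: (aff_RZ AP).
  - by rewrite [RHS]rmorphM !hatE; apply: (wreath_RM RSP).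
  - by rewrite [RHS]rmorph1 hatE; apply: (aff_R1 AP).
  - by rewrite [RHS]rmorphM !hatE; apply: (wreath_SM RSP).
  - by rewrite [RHS]rmorph1 hatE; apply: (wreath_S1 RSP).
  - by rewrite [LHS]rmorphM [RHS]rmorphM !hatE; apply: (aff_RX AP).
  - by rewrite [LHS]rmorphM [RHS]rmorphM !hatE; apply: (aff_SX AP).
  - rewrite [LHS]rmorphM [RHS]rmorphB [X in _ = X - _]rmorphM !hatE.
    exact: (aff_SXi AP).
  - by rewrite [LHS]rmorphM [RHS]rmorphM !hatE; apply: (wreath_SR RSP).
have [phiB phiM] := quot_lift_is_morphism hat_rel.
pose phi0 : A -> E := quot_lift hat.
pose phi : {rmorphism A -> E} := HB.pack phi0
  (GRing.isZmodMorphism.Build A E phi0 phiB)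
  (GRing.isMonoidMorphism.Build A E phi0 phiM).
have phiE a : phi (quot_pi (awpa_rel B Bdual) a) = hat a by exact: (quot_liftE hat_rel).
exists phi; split=> [c a|i|f|p]; try by rewrite phiE hatE.
by case: (quot_pi_surj a) => b ->; rewrite -quot_piZ !phiE hatZ.
Qed.

End UniversalProperty.

(** A normal monomial x^g' f q acts on the function embed w by shifting the argument
of w by g', multiplying by f and translating by q.  With w the indicator of g, the
value at p and the zero exponent is the coefficient sought. *)
Lemma awpa_coord (g : {ffun 'I_n -> nat}) (p : 'S_n) : exists kap : A -> T,
  [/\ {morph kap : a b / a + b}, forall c a, kap (c *: a) = c *: kap a
    & forall g' f q,
        kap (mon X g' * R f * S q) = if (g' == g) && (q == p) then f else 0].
Proof.
have [phi [phiZ phiX phiR phiS]] := awpa_lift (model_affine_wreath tP).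
pose w (u : 'I_n -> nat) : T := if finfun u == g then 1 else 0.
exists (fun a => (phi a : rop _) (embed w) p (fun=> 0%N)); split.
- by move=> a b; rewrite rmorphD.
- by move=> c a; rewrite phiZ rop_scaleE.
move=> g' f q; rewrite !rmorphM rmorph_prod.
under eq_bigr do rewrite rmorphXn phiX.
rewrite phiR phiS (model_normal_form tP) /w andbC.
have -> : finfun (fun l => 0 + g' l)%N = g' by apply/ffunP => l; rewrite ffunE.
by case: eqP => // _; case: eqP => _; rewrite ?mul1r ?mul0r.
Qed.

End Presentation.

(** * The cyclotomic basis *)

Section TensorData.
Variables (k : comNzRingType) (F : algType k) (tr : {scalar F}).
Variables (I : finType) (B Bdual : I -> F).
Hypotheses (tr_frob : frobenius_trace tr) (tr_sym : symmetric_trace tr).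
Hypotheses (B_basis : is_basis B) (B_dual : dual_basis tr B Bdual).
Variable n : nat.

Lemma tensor_wreath_data :
  wreath_data (@tensor_perm k F n) (@teleporter k F n I B Bdual).
Proof.
split.
- by move=> p f g; rewrite rmorphD.
- by move=> p f g; rewrite rmorphM.
- exact: tensor_permZ.
- exact: tensor_perm1.
- exact: tensor_permM.
- by move=> i j f ij; apply: (teleporterC tr_frob tr_sym B_basis B_dual).
- by move=> p i j; apply: teleporter_perm.
- by move=> i j ij; apply: (teleporter_sym tr_frob tr_sym B_basis B_dual).
Qed.

Lemma tensor_basis : is_basis
  (fun b : {ffun 'I_n -> I} => pure_tensor [ffun i => B (b i)] : tensorPower F n).
Proof.
split=> [f|c c0 b]; first exact/span_family/(basis_tensor_span B_basis B_dual).
have [kappa [kD kZ kE]] := tensor_coord B_basis B_dual b.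
have k0 : kappa 0 = 0 by rewrite -(scale0r 0) kZ mul0r.
have := etrans (esym (functional_sum c _ kD kZ)) (etrans (congr1 kappa c0) k0).
rewrite (bigD1 b) //= kE eqxx mulr1.
by rewrite big1 ?addr0 // => b' /negbTE bb'; rewrite kE bb' mulr0.
Qed.

End TensorData.

Theorem corollary6p12
  (k : comNzRingType) (k_char : 2%N \notin [pchar k])
  (F : algType k) (gr : nat -> F -> Prop) (delta : nat) (tr : {scalar F})
  (I : finType) (B Bdual : I -> F)
  (gr_grading : is_grading gr) (gr_max : max_degree gr delta)
  (tr_homog : homogeneous_trace gr tr) (tr_frob : frobenius_trace tr)
  (tr_sym : symmetric_trace tr)
  (B_basis : is_basis B) (B_homog : homogeneous_family gr B)
  (B_dual : dual_basis tr B Bdual)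
  (n : nat) (n_gt0 : (0 < n)%N) (d : nat) (C : 'I_d -> tensorPower F n)
  (C_center : forall j, center_tensor (C j))
  (C_inv : forall j, perm_invariant (C j))
  (C_degree : forall j, tensor_homog gr delta (C j)) :
  is_basis (@cyclotomic_monomial k F n I B Bdual n_gt0 d C).
Proof.
have tP := tensor_wreath_data tr_frob tr_sym B_basis B_dual n.
have AP := awpa_affine_wreath tP.
have relE a : @cyclotomic_rel k F n I B Bdual n_gt0 d C a <->
    a = cyclo (@teleporter k F n I B Bdual)
    (@awpa_tensor k F n I B Bdual) (@awpa_perm k F n I B Bdual)
    (@awpa_x k F n I B Bdual) C (Ordinal n_gt0).
  rewrite /cyclotomic_rel /cyclo.
  by under [in X in _ <-> _ = X]eq_bigr do rewrite jm_shift_first.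
have [kap kapP] := choice (fun x : {ffun 'I_n -> nat} * 'S_n => awpa_coord tP x.1 x.2).
have C_comm c f : C c * f = f * C c by apply: center_tensorC.
have [span_ind free_ind] := cyclo_basis AP C_comm C_inv relE (awpa_total tP)
  (kap := fun g p => kap (g, p)) (fun g p => let: And3 H _ _ := kapP (g, p) in H)
  (fun g p => let: And3 _ H _ := kapP (g, p) in H)
  (fun g p => let: And3 _ _ H := kapP (g, p) in H)
  (tensor_basis B_basis B_dual n).
have E e : @cyclotomic_monomial k F n I B Bdual n_gt0 d C e =
  quot_pi (@cyclotomic_rel k F n I B Bdual n_gt0 d C)
  (mon (@awpa_x k F n I B Bdual) (expo_of e.1.1)
    * awpa_tensor B Bdual (pure_tensor [ffun i => B (e.1.2 i)])
    * awpa_perm B Bdual e.2).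
  by case: e => [[alpha b] p]; rewrite mon_expo_of.
split=> [m|c].
  by have [c ->] := span_ind m; exists c; apply: eq_bigr => e _; rewrite E.
by under eq_bigr do rewrite E; apply: free_ind.
Qed.
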